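(* Let $\beta\neq0$ be real and equip $\mathrm{GL}^+(n)$ with the left-invariant metric whose quadratic form on the Lie algebra $\mathfrak{gl}(n)=\mathbb R^{n\times n}$ is $$\mathtt X\mapsto\operatorname{Tr}\mathtt X^2-(\beta+1)\operatorname{Tr}\mathtt X_{\mathrm{skew}}\mathtt X_{\mathrm{skew}}=\operatorname{Tr}\mathtt X_{\mathrm{sym}}^2+\beta\operatorname{Tr}\mathtt X_{\mathrm{skew}}^{\mathsf T}\mathtt X_{\mathrm{skew}}.$$ Then the Levi-Civita connection is given by the Christoffel function $$\Gamma(\xi,\eta)=-\tfrac12(\xi X^{-1}\eta+\eta X^{-1}\xi)+\tfrac{1+\beta}4X\big([X^{-1}\xi,(X^{-1}\eta)^{\mathsf T}]+[X^{-1}\eta,(X^{-1}\xi)^{\mathsf T}]\big)$$ for $\xi,\eta\in T_X\mathrm{GL}^+(n)$. The geodesic starting at $X$ with initial velocity $\xi=X\mathtt V$ is $$\gamma(t)=X\exp\!\Big(\tfrac t2\big((1-\beta)\mathtt V+(1+\beta)\mathtt V^{\mathsf T}\big)\Big)\exp\!\big(t(1+\beta)\mathtt V_{\mathrm{skew}}\big).$$ Parallel transport of a tangent vector $\eta$ at $X$ along $\gamma(t)$ is $$\mathtt T_0^t(\gamma)\eta=X\exp\!\Big(\tfrac t2\big((1-\beta)\mathtt V+(1+\beta)\mathtt V^{\mathsf T}\big)\Big)\operatorname{expv}(t\mathrm P,X^{-1}\eta)\exp\!\big(t(1+\beta)\mathtt V_{\mathrm{skew}}\big),$$ where $\mathrm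 P=\mathrm P_{\mathtt V}$ is the operator $$\mathrm P_{\mathtt V}\mathtt B=\tfrac12\Big([\mathtt B,\mathtt V]+(1+\beta)\big([\mathtt V_{\mathrm{skew}},\mathtt B]-[\mathtt B_{\mathrm{skew}},\mathtt V]\big)\Big).$$
   Context: $\mathrm{GL}^+(n)$ is the group of real $n\times n$ matrices with positive determinant. $M_{\mathrm{sym}}=\frac12(M+M^{\mathsf T})$, $M_{\mathrm{skew}}=\frac12(M-M^{\mathsf T})$. The metric at $X$ is $\langle\xi,\eta\rangle_X=\langle X^{-1}\xi,X^{-1}\eta\rangle$ with $\langle,\rangle$ the polarization of the quadratic form (it is pseudo-Riemannian, and Riemannian for $\beta>0$). The Christoffel function is defined by $\nabla_{\mathtt Y}\mathtt Z=\mathrm D_{\mathtt Y}\mathtt Z+\Gamma(\mathtt Y,\mathtt Z)$ with $\nabla$ the Levi-Civita connection, vector fields regarded as matrix-valued functions and $\mathrm D$ the directional derivative. $[\cdot,\cdot]$ is the matrix commutator, $\exp$ the matrix exponential, and $\operatorname{expv}(t\mathrm P,v)=e^{t\mathrm P}v$ for a linear operator $\mathrm P$ on $\mathbb R^{n\times n}$. *)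

(* Defs.v *)
From HB Require Import structures.
From mathcomp Require Import all_boot all_order all_algebra.
From mathcomp Require Import all_classical all_reals all_analysis.

Set Implicit Arguments.
Unset Strict Implicit.
Unset Printing Implicit Defensive.

Import Order.TTheory GRing.Theory Num.Theory.
Import numFieldNormedType.Exports.

Local Open Scope classical_set_scope.
Local Open Scope ring_scope.

Definition GLp (R : realType) (n : nat) : set 'M[R]_n := [set X | 0 < \det X].

Definition msym (R : realType) (n : nat) (A : 'M[R]_n) : 'M[R]_n :=
  2^-1 *: (A + A^T).

Definition mskew (R : realType) (n : nat) (A : 'M[R]_n) : 'M[R]_n :=
  2^-1 *: (A - A^T).

Definition mcomm (R : realType) (n : nat) (A B : 'M[R]_n) : 'M[R]_n :=
  A *m B - B *m A.

Definition mexp (R : realType) (n : nat) (A : 'M[R]_n) : 'M[R]_n :=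
  lim (series (fun k => (k`!%:R)^-1 *: A ^+ k) @ \oo).

(* [e^P v], where [e^P] is the exponential of the matrix of [P] in the standard
   basis of R^(n x n); [mxvec] and [lin_mx] use row vectors, so matrices act on
   the right. *)
Definition expv (R : realType) (n : nat) (P : {linear 'M[R]_n -> 'M[R]_n})
    (v : 'M[R]_n) : 'M[R]_n :=
  vec_mx (mxvec v *m mexp (lin_mx P)).

Fixpoint Ck (R : realType) (V W : normedModType R) (U : set V) (k : nat)
    (f : V -> W) : Prop :=
  if k is k'.+1 then
    (forall x, U x -> differentiable f x) /\ (forall v, Ck U k' ('D_v f))
  else forall x, U x -> {for x, continuous f}.

(* Meant for open [U]; the values of [f] outside [U] are irrelevant. *)
Definition smooth_on (R : realType) (V W : normedModType R) (U : set V)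
    (f : V -> W) : Prop := forall k, Ck U k f.

(* GL+(n) is open in R^(n x n), so every tangent space is R^(n x n) and a
   vector field is a map from matrices to matrices, considered on GL+(n) only;
   [g X] is the bilinear form at X, and [nabla Y Z] stands for the covariant
   derivative of Z along Y. *)

Record affine_connection (R : realType) (n : nat)
    (nabla : ('M[R]_n -> 'M[R]_n) -> ('M[R]_n -> 'M[R]_n) -> 'M[R]_n -> 'M[R]_n)
    : Prop := AffineConnection {
  conn_smooth : forall Y Z : 'M[R]_n -> 'M[R]_n,
    smooth_on (@GLp R n) Y -> smooth_on (@GLp R n) Z ->
    smooth_on (@GLp R n) (nabla Y Z);
  conn_addl : forall Y1 Y2 Z : 'M[R]_n -> 'M[R]_n,
    smooth_on (@GLp R n) Y1 -> smooth_on (@GLp R n) Y2 ->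
    smooth_on (@GLp R n) Z ->
    forall X, GLp X ->
      nabla (fun A => Y1 A + Y2 A) Z X = nabla Y1 Z X + nabla Y2 Z X;
  conn_scalel : forall (f : 'M[R]_n -> R) (Y Z : 'M[R]_n -> 'M[R]_n),
    smooth_on (@GLp R n) f -> smooth_on (@GLp R n) Y ->
    smooth_on (@GLp R n) Z ->
    forall X, GLp X -> nabla (fun A => f A *: Y A) Z X = f X *: nabla Y Z X;
  conn_addr : forall Y Z1 Z2 : 'M[R]_n -> 'M[R]_n,
    smooth_on (@GLp R n) Y -> smooth_on (@GLp R n) Z1 ->
    smooth_on (@GLp R n) Z2 ->
    forall X, GLp X ->
      nabla Y (fun A => Z1 A + Z2 A) X = nabla Y Z1 X + nabla Y Z2 X;
  conn_leibniz : forall (f : 'M[R]_n -> R) (Y Z : 'M[R]_n -> 'M[R]_n),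
    smooth_on (@GLp R n) f -> smooth_on (@GLp R n) Y ->
    smooth_on (@GLp R n) Z ->
    forall X, GLp X ->
      nabla Y (fun A => f A *: Z A) X = 'D_(Y X) f X *: Z X + f X *: nabla Y Z X
}.

(* The right-hand side is the Lie bracket of vector fields on an open set. *)
Definition torsion_free (R : realType) (n : nat)
    (nabla : ('M[R]_n -> 'M[R]_n) -> ('M[R]_n -> 'M[R]_n) -> 'M[R]_n -> 'M[R]_n)
    : Prop :=
  forall Y Z : 'M[R]_n -> 'M[R]_n,
    smooth_on (@GLp R n) Y -> smooth_on (@GLp R n) Z ->
    forall X, GLp X ->
      nabla Y Z X - nabla Z Y X = 'D_(Y X) Z X - 'D_(Z X) Y X.

Definition metric_compatible (R : realType) (n : nat)
    (g : 'M[R]_n -> 'M[R]_n -> 'M[R]_n -> R)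
    (nabla : ('M[R]_n -> 'M[R]_n) -> ('M[R]_n -> 'M[R]_n) -> 'M[R]_n -> 'M[R]_n)
    : Prop :=
  forall Y Z W : 'M[R]_n -> 'M[R]_n,
    smooth_on (@GLp R n) Y -> smooth_on (@GLp R n) Z ->
    smooth_on (@GLp R n) W ->
    forall X, GLp X ->
      'D_(Y X) (fun A => g A (Z A) (W A)) X =
      g X (nabla Y Z X) (W X) + g X (Z X) (nabla Y W X).

Definition levi_civita (R : realType) (n : nat)
    (g : 'M[R]_n -> 'M[R]_n -> 'M[R]_n -> R)
    (nabla : ('M[R]_n -> 'M[R]_n) -> ('M[R]_n -> 'M[R]_n) -> 'M[R]_n -> 'M[R]_n)
    : Prop :=
  [/\ affine_connection nabla, torsion_free nabla & metric_compatible g nabla].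

(* [Gam X xi eta] is the value at the point X on the tangent vectors xi, eta. *)
Definition given_by_christoffel (R : realType) (n : nat)
    (nabla : ('M[R]_n -> 'M[R]_n) -> ('M[R]_n -> 'M[R]_n) -> 'M[R]_n -> 'M[R]_n)
    (Gam : 'M[R]_n -> 'M[R]_n -> 'M[R]_n -> 'M[R]_n) : Prop :=
  forall Y Z : 'M[R]_n -> 'M[R]_n,
    smooth_on (@GLp R n) Y -> smooth_on (@GLp R n) Z ->
    forall X, GLp X -> nabla Y Z X = 'D_(Y X) Z X + Gam X (Y X) (Z X).

(* The Christoffel function of [nabla]: the directional derivative of a constant
   field vanishes. *)
Definition christoffel (R : realType) (n : nat)
    (nabla : ('M[R]_n -> 'M[R]_n) -> ('M[R]_n -> 'M[R]_n) -> 'M[R]_n -> 'M[R]_n)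
    (X xi eta : 'M[R]_n) : 'M[R]_n :=
  nabla (fun=> xi) (fun=> eta) X.

(* Covariant derivative at time [t] of the vector field [W] along the curve
   [c]. *)
Definition covariant_derivative (R : realType) (n : nat)
    (nabla : ('M[R]_n -> 'M[R]_n) -> ('M[R]_n -> 'M[R]_n) -> 'M[R]_n -> 'M[R]_n)
    (c W : R -> 'M[R]_n) (t : R) : 'M[R]_n :=
  derive1 W t + christoffel nabla (c t) (derive1 c t) (W t).

Definition geodesic (R : realType) (n : nat)
    (nabla : ('M[R]_n -> 'M[R]_n) -> ('M[R]_n -> 'M[R]_n) -> 'M[R]_n -> 'M[R]_n)
    (I : set R) (c : R -> 'M[R]_n) : Prop :=
  [/\ smooth_on I c, forall t, I t -> GLp (c t) &
      forall t, I t -> covariant_derivative nabla c (derive1 c) t = 0].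

Definition parallel_field (R : realType) (n : nat)
    (nabla : ('M[R]_n -> 'M[R]_n) -> ('M[R]_n -> 'M[R]_n) -> 'M[R]_n -> 'M[R]_n)
    (I : set R) (c W : R -> 'M[R]_n) : Prop :=
  smooth_on I W /\ forall t, I t -> covariant_derivative nabla c W t = 0.

(* [zeta] is the parallel transport of [eta] along [c], defined on [I], from
   time [s] to time [t]. *)
Definition parallel_transport (R : realType) (n : nat)
    (nabla : ('M[R]_n -> 'M[R]_n) -> ('M[R]_n -> 'M[R]_n) -> 'M[R]_n -> 'M[R]_n)
    (I : set R) (c : R -> 'M[R]_n) (s t : R) (eta zeta : 'M[R]_n) : Prop :=
  exists W : R -> 'M[R]_n,
    [/\ parallel_field nabla I c W, W s = eta & W t = zeta].

Definition qform (R : realType) (n : nat) (beta : R) (A : 'M[R]_n) : R :=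
  \tr (A *m A) - (beta + 1) * \tr (mskew A *m mskew A).

Definition polarization (R : realType) (n : nat) (q : 'M[R]_n -> R)
    (A B : 'M[R]_n) : R :=
  (q (A + B) - q A - q B) / 2.

Definition metric (R : realType) (n : nat) (beta : R)
    (X xi eta : 'M[R]_n) : R :=
  polarization (qform beta) (invmx X *m xi) (invmx X *m eta).

Definition Gamma (R : realType) (n : nat) (beta : R)
    (X xi eta : 'M[R]_n) : 'M[R]_n :=
  - (2^-1 *: (xi *m invmx X *m eta + eta *m invmx X *m xi))
  + ((1 + beta) / 4) *: (X *m
      (mcomm (invmx X *m xi) (invmx X *m eta)^T
       + mcomm (invmx X *m eta) (invmx X *m xi)^T)).

Definition geod (R : realType) (n : nat) (beta : R) (X V : 'M[R]_n)
    (t : R) : 'M[R]_n :=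
  X *m mexp ((t / 2) *: ((1 - beta) *: V + (1 + beta) *: V^T))
    *m mexp ((t * (1 + beta)) *: mskew V).

Definition Pop (R : realType) (n : nat) (beta : R) (V B : 'M[R]_n) : 'M[R]_n :=
  2^-1 *: (mcomm B V
           + (1 + beta) *: (mcomm (mskew V) B - mcomm (mskew B) V)).

Lemma Pop_is_linear (R : realType) (n : nat) (beta : R) (V : 'M[R]_n) :
  linear (Pop beta V).
Proof.
have skewD (a : R) (A B : 'M[R]_n) :
    mskew (a *: A + B) = a *: mskew A + mskew B.
  rewrite /mskew linearP /= opprD addrACA -scalerBr scalerDr !scalerA.
  by rewrite [_ * a]mulrC.
have commDl (a : R) (A B C : 'M[R]_n) :
    mcomm (a *: A + B) C = a *: mcomm A C + mcomm B C.
  rewrite /mcomm mulmxDl mulmxDr -scalemxAl -scalemxAr opprD addrACA.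
  by rewrite -scalerBr.
have commDr (a : R) (A B C : 'M[R]_n) :
    mcomm C (a *: A + B) = a *: mcomm C A + mcomm C B.
  rewrite /mcomm mulmxDl mulmxDr -scalemxAl -scalemxAr opprD addrACA.
  by rewrite -scalerBr.
move=> a A B; rewrite /Pop skewD !commDl commDr opprD addrACA -scalerBr.
rewrite [(1 + beta) *: (a *: _ + _)]scalerDr scalerA mulrC -scalerA.
by rewrite addrACA -scalerDr [LHS]scalerDr scalerA mulrC -scalerA.
Qed.

HB.instance Definition _ (R : realType) (n : nat) (beta : R) (V : 'M[R]_n) :=
  GRing.isLinear.Build R 'M[R]_n 'M[R]_n _ (Pop beta V)
    (@Pop_is_linear R n beta V).

Definition transport (R : realType) (n : nat) (beta : R) (X V eta : 'M[R]_n)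
    (t : R) : 'M[R]_n :=
  X *m mexp ((t / 2) *: ((1 - beta) *: V + (1 + beta) *: V^T))
    *m expv (t \*: Pop beta V) (invmx X *m eta)
    *m mexp ((t * (1 + beta)) *: mskew V).

(* Main.v *)
Require Import Defs.
From HB Require Import structures.
From mathcomp Require Import all_boot all_order all_algebra.
From mathcomp Require Import all_classical all_reals all_analysis.
From mathcomp Require Import ring lra.

Set Implicit Arguments.
Unset Strict Implicit.
Unset Printing Implicit Defensive.

Import Order.TTheory GRing.Theory Num.Theory.
Import numFieldNormedType.Exports.

Local Open Scope classical_set_scope.
Local Open Scope ring_scope.

(** Left translation moves every assertion to the Lie algebra.  Write tangent
    vectors at X as X A, and put p = (1 - beta)/2, q = (1 + beta)/2.  The metric
    becomes the constant bilinear form p tr(A B) + q tr(A B^T) ([metric_form]),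
    and Gamma becomes X [body_Gamma] A B.

    Levi-Civita connection.  D + Gamma is torsion-free because Gamma is
    symmetric.  Differentiating A |-> A^-1 Z reduces metric compatibility to an
    identity between traces of three matrices, which follows from invariance of
    the trace under cyclic rotation and transposition ([metric_form_Gamma]).
    Conversely the difference of two Levi-Civita connections, paired with a
    third field, is symmetric in two arguments and antisymmetric in two others,
    hence zero; the form is nondegenerate because beta <> 0
    ([levi_civita_unique]).

    Geodesics.  If c' = c w, the geodesic equation is w' = - q [w, w^T].  Its
    right-hand side is symmetric, so w - w^T keeps its initial value V - V^T.
    With S = q (V - V^T) the equation is therefore linear, w' = [w, S], and its
    solution is e^(-tS) V e^(tS).  Since V = A + S with A = p V + q V^T, the curve
    X e^(tA) e^(tS) has exactly this velocity.  Each uniqueness step exhibits a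
    curve with zero derivative on an interval: first w - w^T, then
    e^(tS) w e^(-tS), then c e^(-tS) e^(-tA) ([geodesic_eq_geod]).

    Parallel transport.  S is skew, so e^(tS) is orthogonal and conjugation by it
    commutes with products and with transposition, hence with the connection in
    left-trivialized form.  In the moving frame B |-> X e^(tA) B e^(tS) the
    covariant derivative is B' - P B ([covariant_derivative_frame]), so parallel
    fields are the solutions of a linear equation with constant coefficients.

    The analysis needed is the closure of C^k maps under the matrix operations,
    proved entry by entry, and the derivative of the matrix exponential, proved
    by differentiating the power series of each entry. *)

(** * Differential calculus of matrix-valued maps *)

(** The differential of f at x is also a first-order approximation of g there. *)
Lemma near_eq_differentiable (R : realType) (V W : normedModType R)
    (f g : V -> W) (x : V) :
  {near x, f =1 g} -> differentiable f x -> differentiable g x.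
Proof.
move=> fg df; apply/diffP.
apply: (@getPex _ (fun (df : {linear V -> W}) => continuous df /\
  forall y, g y = g (lim (nbhs x)) + df (y - lim (nbhs x))
                  +o_(y \near x) (y - lim (nbhs x)))).
exists ('d f x); split; first exact: diff_continuous.
rewrite !lim_id//.
set df0 := fun y => f x + 'd f x (y - x).
have Ef : f = df0 +o_x (center x).
  by apply/funext => y; rewrite [LHS](diffE df) lim_id.
suff Eg : g = df0 +o_x (center x).
  by move=> y; rewrite [LHS](congr1 (@^~ y) Eg) /df0 (nbhs_singleton fg).
move/eqaddoP : Ef => Ef; apply/eqaddoP => e e0.
near=> y; rewrite /= !fctE -(near fg y)//.
  by near: y; exact: Ef.
Unshelve. all: by end_near. Qed.

Lemma differentiable_mxP (R : realType) (V : normedModType R) m n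
    (f : V -> 'M[R]_(m, n)) (x : V) :
  differentiable f x <-> forall i j, differentiable (fun y => f y i j) x.
Proof.
split=> [df i j|df].
  exact: (differentiable_comp df (differentiable_coord _ _ _)).
rewrite (_ : f = \sum_(p : 'I_m * 'I_n)
   (fun y => f y p.1 p.2 *: (delta_mx p.1 p.2 : 'M[R]_(m, n)))); last first.
  by apply/funext => y; rewrite fct_sumE {1}[f y]matrix_sum_delta pair_bigA.
elim/big_ind : _ => [||p _].
- exact: differentiable_cst.
- by move=> g h dg dh; exact: differentiableD.
- exact: differentiableZl.
Qed.

Lemma cvg_mxP (R : realType) m n (T : Type) (F : set_system T) {FF : Filter F}
    (f : T -> 'M[R]_(m, n)) (M : 'M[R]_(m, n)) :
  f @ F --> M <-> forall i j, (fun x => f x i j) @ F --> M i j.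
Proof.
split=> [cf i j|cf].
  exact: (cvg_comp f (fun M : 'M[R]_(m, n) => M i j) cf
            (@coord_continuous _ _ _ _ _ _)).
apply/cvg_mx_entourageP => A entA; near=> y => i j.
move: i j; near: y; apply: filter_forall => i; apply: filter_forall => j.
have /cvg_entourageP/(_ A entA) := cf i j.
by apply: (@filterS _ F) => z /mem_set.
Unshelve. all: by end_near. Qed.

Lemma derive_mxE (R : realType) (V : normedModType R) m n
    (f : V -> 'M[R]_(m, n)) (x v : V) i j :
  derivable f x v -> 'D_v f x i j = 'D_v (fun y => f y i j) x.
Proof. by move=> /derive_mx ->; rewrite mxE. Qed.

Lemma is_derive_mxP (R : realType) (V : normedModType R) m n
    (f : V -> 'M[R]_(m, n)) (x v : V) (df : 'M[R]_(m, n)) :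
  is_derive x v f df <->
  forall i j, is_derive x v (fun y => f y i j) (df i j).
Proof.
split=> [[dfx <-] i j|df_].
  apply: DeriveDef; first by move/derivable_mxP : dfx.
  by rewrite derive_mxE.
have dfx : derivable f x v by apply/derivable_mxP => i j; exact: ex_derive.
apply: DeriveDef => //; apply/matrixP => i j.
by rewrite derive_mxE// (@derive_val _ _ _ _ _ _ _ (df_ i j)).
Qed.

Lemma is_derive_mulmx (R : realType) (V : normedModType R) m n p
    (f : V -> 'M[R]_(m, n)) (g : V -> 'M[R]_(n, p)) (x v : V) df dg :
  is_derive x v f df -> is_derive x v g dg ->
  is_derive x v (fun y => f y *m g y) (df *m g x + f x *m dg).
Proof.
move=> /is_derive_mxP df_ /is_derive_mxP dg_; apply/is_derive_mxP => i j.
rewrite (_ : (fun _ => _) = \sum_k ((fun y => f y i k) * (fun y => g y k j))).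
  apply: (is_derive_eq
    (is_derive_sum (fun k => is_deriveM (df_ i k) (dg_ k j))));
 rewrite !mxE -big_split; apply: eq_bigr => k _ /=.
  by rewrite addrC; congr (_ + _); exact: mulrC.
by apply/funext => y; rewrite fct_sumE mxE.
Qed.

Lemma is_derive_mulmxl (R : realType) (V : normedModType R) m n p
    (C : 'M[R]_(m, n)) (f : V -> 'M[R]_(n, p)) (x v : V) (df : 'M[R]_(n, p)) :
  is_derive x v f df -> is_derive x v (fun y => C *m f y) (C *m df).
Proof.
move=> dfx; apply: (is_derive_eq (is_derive_mulmx (is_derive_cst C x v) dfx)).
by rewrite mul0mx add0r.
Qed.

Lemma is_derive_mxvec (R : realType) (V : normedModType R) m n
    (f : V -> 'M[R]_(m, n)) (x v : V) (df : 'M[R]_(m, n)) :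
  is_derive x v f df -> is_derive x v (fun y => mxvec (f y)) (mxvec df).
Proof.
move=> /is_derive_mxP df_; apply/is_derive_mxP => i k.
rewrite ord1; case/mxvec_indexP: k => i' j'; rewrite mxvecE.
rewrite (_ : (fun _ => _) = (fun y => f y i' j')) //.
by apply/funext => y; rewrite mxvecE.
Qed.

Lemma is_derive_vec_mx (R : realType) (V : normedModType R) m n
    (f : V -> 'rV[R]_(m * n)) (x v : V) (df : 'rV[R]_(m * n)) :
  is_derive x v f df -> is_derive x v (fun y => vec_mx (f y)) (vec_mx df).
Proof.
move=> /is_derive_mxP df_; apply/is_derive_mxP => i j; rewrite mxE.
rewrite (_ : (fun _ => _) = (fun y => f y 0 (mxvec_index i j))) //.
by apply/funext => y; rewrite mxE.
Qed.

Lemma is_derive_mxtrace (R : realType) (V : normedModType R) n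
    (f : V -> 'M[R]_n) (x v : V) (df : 'M[R]_n) :
  is_derive x v f df -> is_derive x v (fun y => \tr (f y)) (\tr df).
Proof.
move=> /is_derive_mxP df_.
rewrite (_ : (fun _ => _) = \sum_i (fun y => f y i i)); last first.
  by apply/funext => y; rewrite fct_sumE.
by apply: is_derive_sum => i; exact: df_.
Qed.

Lemma is_derive_trmx (R : realType) (V : normedModType R) m n
    (f : V -> 'M[R]_(m, n)) (x v : V) (df : 'M[R]_(m, n)) :
  is_derive x v f df -> is_derive x v (fun y => (f y)^T) df^T.
Proof.
move=> /is_derive_mxP df_; apply/is_derive_mxP => i j.
rewrite mxE (_ : (fun _ => _) = (fun y => f y j i)) //.
by apply/funext => y; rewrite mxE.
Qed.

Section Ck.
Variables (R : realType) (V : normedModType R) (U : set V).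
Hypothesis openU : open U.

(** Derivative formulas are known on U only, while [Ck] iterates directional
    derivatives of total functions; openness of U makes the values elsewhere
    irrelevant. *)
Lemma Ck_ext (W : normedModType R) k (f g : V -> W) :
  (forall x, U x -> f x = g x) -> Ck U k f -> Ck U k g.
Proof.
have near_fg (f' g' : V -> W) x : (forall x, U x -> f' x = g' x) -> U x ->
    \near x, f' x = g' x.
  by move=> fg Ux; near do apply: fg; exact: open_nbhs_nbhs.
elim: k f g => [|k IH] f g fg /=.
  move=> cf x Ux; rewrite /= /prop_for /continuous_at -(fg x Ux).
  by apply: cvg_trans (cf x Ux); apply: near_eq_cvg; exact: near_fg.
move=> [df Df]; split=> [x Ux|v].
  by apply: near_eq_differentiable (df x Ux); exact: near_fg.
by apply: IH (Df v) => x Ux; apply: near_eq_derive; exact: near_fg.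
Unshelve. all: by end_near. Qed.

Lemma Ck_S (W : normedModType R) k (f : V -> W) : Ck U k.+1 f -> Ck U k f.
Proof.
elim: k f => [f [df _] x Ux|k IH f [df Df]].
  exact/differentiable_continuous/df.
by split=> // v; exact/IH/Df.
Qed.

(** Reduces the regularity of a matrix-valued map to that of its entries, where
    the calculus of scalar functions applies. *)
Lemma Ck_mxP m n k (f : V -> 'M[R]_(m, n)) :
  Ck U k f <-> forall i j, Ck U k (fun x => f x i j).
Proof.
elim: k f => [|k IH] f /=.
  split=> [cf i j x Ux|cf x Ux]; last by apply/cvg_mxP => i j; exact: cf.
  by have /cvg_mxP := cf x Ux; exact.
split=> [[df Df] i j|df].
  split=> [x Ux|v]; first by move/differentiable_mxP : (df x Ux).
  have /IH/(_ i j) := Df v; apply: Ck_ext => x Ux.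
  by rewrite derive_mxE//; exact/diff_derivable/df.
have dfx x : U x -> differentiable f x.
  by move=> Ux; apply/differentiable_mxP => i j; have [+ _] := df i j; exact.
split=> // v; apply/IH => i j; have [_ /(_ v)] := df i j.
by apply: Ck_ext => x Ux; rewrite derive_mxE//; exact/diff_derivable/dfx.
Qed.


Lemma Ck_cst (W : normedModType R) k (c : W) : Ck U k (fun=> c).
Proof.
elim: k c => [|k IH] c /=; first by move=> x _; exact: cvg_cst.
split=> [x _|v]; first exact: differentiable_cst.
rewrite (_ : 'D_v _ = fun=> 0) //.
by apply/funext => x; exact: derive_cst.
Qed.

Lemma CkD (W : normedModType R) k (f g : V -> W) :
  Ck U k f -> Ck U k g -> Ck U k (fun x => f x + g x).
Proof.
elim: k f g => [|k IH] f g /=.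
  by move=> cf cg x Ux; apply: cvgD; [exact: cf|exact: cg].
move=> [df Df] [dg Dg]; split=> [x Ux|v].
  by apply: differentiableD; [exact: df|exact: dg].
apply: Ck_ext (IH _ _ (Df v) (Dg v)) => x Ux.
by rewrite -deriveD//; apply: diff_derivable; [exact: df|exact: dg].
Qed.

Lemma CkM k (f g : V -> R) :
  Ck U k f -> Ck U k g -> Ck U k (fun x => f x * g x).
Proof.
elim: k f g => [|k IH] f g.
  by move=> cf cg x Ux; apply: cvgM; [exact: cf|exact: cg].
move=> Cf Cg; have [[df Df] [dg Dg]] := (Cf, Cg); split=> [x Ux|v].
  by apply: differentiableM; [exact: df|exact: dg].
apply: Ck_ext (CkD (IH _ _ (Ck_S Cf) (Dg v)) (IH _ _ (Ck_S Cg) (Df v))) => x Ux.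
by rewrite [RHS](@deriveM _ _ f g)//; apply: diff_derivable; [exact: df|exact: dg].
Qed.

Lemma CkN (W : normedModType R) k (f : V -> W) :
  Ck U k f -> Ck U k (fun x => - f x).
Proof.
elim: k f => [|k IH] f /=; first by move=> cf x Ux; apply: cvgN; exact: cf.
move=> [df Df]; split=> [x Ux|v]; first exact/differentiableN/df.
apply: Ck_ext (IH _ (Df v)) => x Ux.
by rewrite [RHS](@deriveN _ _ _ f)//; exact/diff_derivable/df.
Qed.

Lemma CkV k (f : V -> R) : (forall x, U x -> f x != 0) ->
  Ck U k f -> Ck U k (fun x => (f x)^-1).
Proof.
move=> f0; elim: k => [|k IH].
  by move=> cf x Ux; apply: cvgV; [exact: f0|exact: cf].
move=> Cf; have [df Df] := Cf; split=> [x Ux|v].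
  by apply: differentiableV; [exact: df|exact: f0].
have Vf := IH (Ck_S Cf).
apply: Ck_ext (CkN (CkM (CkM Vf Vf) (Df v))) => x Ux.
rewrite [RHS](@deriveV _ _ f)//; [|exact: f0|exact/diff_derivable/df].
by rewrite -scaleNr -invfM.
Qed.

Lemma Ck_sum (W : normedModType R) k (I : Type) (r : seq I) (P : pred I)
    (F : I -> V -> W) : (forall i, P i -> Ck U k (F i)) ->
  Ck U k (fun x => \sum_(i <- r | P i) F i x).
Proof.
move=> CF; rewrite (_ : (fun _ => _) = \sum_(i <- r | P i) F i); last first.
  by apply/funext => x; rewrite fct_sumE.
by elim/big_ind : _ => //; [exact: Ck_cst|exact: CkD].
Qed.

Lemma Ck_prod k (I : Type) (r : seq I) (P : pred I)
    (F : I -> V -> R) : (forall i, P i -> Ck U k (F i)) ->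
  Ck U k (fun x => \prod_(i <- r | P i) F i x).
Proof.
move=> CF; rewrite (_ : (fun _ => _) = \prod_(i <- r | P i) F i); last first.
  by apply/funext => x; rewrite fct_prodE.
by elim/big_ind : _ => //; [exact: Ck_cst|exact: CkM].
Qed.

Lemma CkZ m n k (f : V -> R) (g : V -> 'M[R]_(m, n)) :
  Ck U k f -> Ck U k g -> Ck U k (fun x => f x *: g x).
Proof.
move=> Cf /Ck_mxP Cg; apply/Ck_mxP => i j.
by apply: Ck_ext (CkM Cf (Cg i j)) => x _; rewrite mxE.
Qed.

Lemma Ck_mulmx m n p k (f : V -> 'M[R]_(m, n)) (g : V -> 'M[R]_(n, p)) :
  Ck U k f -> Ck U k g -> Ck U k (fun x => f x *m g x).
Proof.
move=> /Ck_mxP Cf /Ck_mxP Cg; apply/Ck_mxP => i j.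
have : Ck U k (fun x => \sum_l f x i l * g x l j).
  by apply: Ck_sum => l _; exact: CkM.
by apply: Ck_ext => x _; rewrite mxE.
Qed.

Lemma Ck_trmx m n k (f : V -> 'M[R]_(m, n)) :
  Ck U k f -> Ck U k (fun x => (f x)^T).
Proof.
move=> /Ck_mxP Cf; apply/Ck_mxP => i j.
by apply: Ck_ext (Cf j i) => x _; rewrite mxE.
Qed.

Lemma Ck_det n k (f : V -> 'M[R]_n) :
  Ck U k f -> Ck U k (fun x => \det (f x)).
Proof.
move=> /Ck_mxP Cf; apply: Ck_sum => s _.
by apply: CkM; [exact: Ck_cst|apply: Ck_prod => i _; exact: Cf].
Qed.

(** By Cramer's rule the entries of the inverse are rational functions of the
    entries of f, with the determinant as denominator. *)
Lemma Ck_invmx n k (f : V -> 'M[R]_n) :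
  (forall x, U x -> f x \in unitmx) ->
  Ck U k f -> Ck U k (fun x => invmx (f x)).
Proof.
move=> fu Cf.
have : Ck U k (fun x => (\det (f x))^-1 *: \adj (f x)).
  apply: CkZ.
    apply: CkV; last exact: Ck_det.
    by move=> x /fu; rewrite unitmxE unitfE.
  apply/Ck_mxP => i j.
  have : Ck U k (fun x => (-1) ^+ (j + i) * \det (row' j (col' i (f x)))).
    apply: CkM; first exact: Ck_cst.
    apply: Ck_det; apply/Ck_mxP => i' j'.
    move/Ck_mxP : Cf => /(_ (lift j i') (lift i j')).
    by apply: Ck_ext => x _; rewrite !mxE.
  by apply: Ck_ext => x _; rewrite mxE.
by apply: Ck_ext => x Ux; rewrite /invmx fu.
Qed.

Lemma Ck_is_derive (W : normedModType R) k (f : V -> W) x v :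
  U x -> Ck U k.+1 f -> is_derive x v f ('D_v f x).
Proof. by move=> Ux [df _]; exact/derivableP/diff_derivable/df. Qed.

(** Differentiate f f^-1 = 1, differentiability of f^-1 being known. *)
Lemma is_derive_invmx n (f : V -> 'M[R]_n) x v df :
  (forall x, U x -> f x \in unitmx) -> Ck U 1 f -> U x ->
  is_derive x v f df ->
  is_derive x v (fun y => invmx (f y)) (- (invmx (f x) *m df *m invmx (f x))).
Proof.
move=> fu Cf Ux dfx.
have dg := Ck_is_derive v Ux (Ck_invmx fu Cf).
have /= dfg := is_derive_mulmx dfx dg.
apply: is_derive_eq.
have : 'D_v (fun y => f y *m invmx (f y)) x = 0.
  rewrite (@near_eq_derive _ _ _ _ (cst 1%:M)) ?derive_cst//.
  near=> y; rewrite mulmxV//; apply: fu.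
  by near: y; exact: open_nbhs_nbhs.
rewrite (@derive_val _ _ _ _ _ _ _ dfg) => /(congr1 (mulmx (invmx (f x)))).
rewrite mulmx0 mulmxDr mulKmx ?fu// mulmxA => /eqP.
by rewrite addrC addr_eq0 => /eqP.
Unshelve. all: by end_near. Qed.

End Ck.

Lemma Ck_coord (R : realType) m n (U : set 'M[R]_(m, n)) k i j :
  Ck U k (fun X : 'M[R]_(m, n) => X i j).
Proof.
have coordC := @coord_continuous R m n i j.
case: k => [x _|k]; first exact: coordC.
split=> [x _|v]; first exact: differentiable_coord.
rewrite (_ : 'D_v _ = fun=> v i j); first exact: Ck_cst.
apply/funext => x.
by rewrite -derive_mxE ?derive_id//; exact: derivable_id.
Qed.

Lemma Ck_id (R : realType) m n (U : set 'M[R]_(m, n)) k :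
  open U -> Ck U k (fun X : 'M[R]_(m, n) => X).
Proof. by move=> openU; apply/(Ck_mxP openU) => i j; exact: Ck_coord. Qed.

(** The direction Y X varies with the point: expand it in the matrix units, so
    that only derivatives in fixed directions remain. *)
Lemma Ck_derive_along (R : realType) m n p q (U : set 'M[R]_(m, n)) k
    (Y : 'M[R]_(m, n) -> 'M[R]_(m, n)) (Z : 'M[R]_(m, n) -> 'M[R]_(p, q)) :
  open U -> Ck U k Y -> Ck U k.+1 Z -> Ck U k (fun X => 'D_(Y X) Z X).
Proof.
move=> openU CY [dZ DZ].
have : Ck U k (fun X => \sum_i \sum_j Y X i j *: 'D_(delta_mx i j) Z X).
  apply: Ck_sum => // i _; apply: Ck_sum => // j _; apply: CkZ => //; last exact: DZ.
  by move/(Ck_mxP openU) : CY.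
apply: Ck_ext => // X UX.
rewrite deriveE; last exact: dZ.
rewrite [in RHS](matrix_sum_delta (Y X)) linear_sum; apply: eq_bigr => i _.
rewrite linear_sum; apply: eq_bigr => j _; rewrite linearZ /=.
by rewrite deriveE//; exact: dZ.
Qed.

Lemma open_GLp (R : realType) n : open (@GLp R n).
Proof.
have CM : Ck [set: 'M[R]_n] 0 (fun X => \det X).
  by apply: Ck_det; [exact: openT|exact/Ck_id/openT].
rewrite (_ : @GLp R n = (fun X => \det X) @^-1` [set x | 0 < x])//.
apply: open_comp; last exact: open_gt.
by move=> X _; exact: CM.
Qed.

Lemma GLp_unitmx (R : realType) n (X : 'M[R]_n) : GLp X -> X \in unitmx.
Proof. by rewrite /GLp /= unitmxE unitfE => /lt0r_neq0. Qed.

(** * The matrix exponential *)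

Lemma cvg_mulmx (R : realType) m n p (T : Type) (F : set_system T) {FF : Filter F}
    (f : T -> 'M[R]_(m, n)) (g : T -> 'M[R]_(n, p))
    (M : 'M[R]_(m, n)) (N : 'M[R]_(n, p)) :
  f @ F --> M -> g @ F --> N -> (fun x => f x *m g x) @ F --> M *m N.
Proof.
move=> /cvg_mxP cf /cvg_mxP cg; apply/cvg_mxP => i j.
rewrite mxE (_ : (fun _ => _) = \sum_k (fun x => f x i k * g x k j)); last first.
  by apply/funext => x; rewrite mxE fct_sumE.
elim/big_ind2 : _ => [||k _]; first exact: cvg_cst.
- by move=> ? ? ? ? ? ?; exact: cvgD.
- by apply: cvgM.
Qed.

Section mexp.
Variables (R : realType) (n : nat).
Implicit Types (A B : 'M[R]_n) (t : R).

Let norm1 A : R := \sum_i \sum_j `|A i j|.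

Lemma norm1_ge0 A : 0 <= norm1 A.
Proof. by apply: sumr_ge0 => i _; apply: sumr_ge0. Qed.

Lemma norm_mulmx_le A B (c : R) : (forall i j, `|B i j| <= c) ->
  forall i j, `|(A *m B) i j| <= norm1 A * c.
Proof.
move=> Bc i j; rewrite mxE (le_trans (ler_norm_sum _ _ _))//.
rewrite /norm1 [in leRHS](bigD1 i)//= mulrDl mulr_suml.
have c0 : 0 <= c by apply: le_trans (Bc i j).
rewrite -[leLHS]addr0 lerD//.
  by apply: ler_sum => k _; rewrite normrM ler_wpM2l.
by rewrite mulr_ge0// sumr_ge0// => k _; rewrite sumr_ge0.
Qed.

(** The sum of the absolute values of all entries is submultiplicative and, unlike
    the maximum norm, needs no dimension factor; so the entries of A^k grow at most
    geometrically and the exponential series of a real number dominates. *)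
Lemma norm_exprmx_le A k i j : `|(A ^+ k) i j| <= norm1 A ^+ k.
Proof.
elim: k i j => [|k IH] i j.
  by rewrite !expr0 mxE; case: eqP; rewrite ?normr1 ?normr0.
by rewrite !exprS; exact: norm_mulmx_le.
Qed.

(** Coefficients of the power series in t of entry (i, j) of B e^(tA).  The left
    factor B makes this family stable under differentiation. *)
Let coef B A i j := fun k => k`!%:R^-1 * (B *m A ^+ k) i j.

Lemma is_cvg_coef B A i j t : cvgn (pseries (coef B A i j) t).
Proof.
apply: normed_cvg.
apply: (@series_le_cvg _ _ (norm1 B *: exp_coeff (norm1 A * `|t|))).
- by move=> k; exact: normr_ge0.
- move=> k; rewrite mulr_ge0 ?norm1_ge0// exp_coeff_ge0//.
  by rewrite mulr_ge0 ?norm1_ge0.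
- move=> k; rewrite /= /coef !normrM normrX normfV normr_nat.
  have := norm_mulmx_le B (norm_exprmx_le A k) i j.
  rewrite !fctE /exp_coeff /= exprMn => H.
  rewrite [leRHS](_ : _ = k`!%:R^-1 * (norm1 B * norm1 A ^+ k) * `|t| ^+ k).
    by rewrite ler_wpM2r ?exprn_ge0// ler_wpM2l// invr_ge0.
  by rewrite /GRing.scale /=; ring.
- by apply: is_cvg_seriesZ; exact: is_cvg_series_exp_coeff.
Qed.

(** Termwise differentiation only changes B into B A, so convergence of the
    series and of its first two derivatives is a single statement. *)
Lemma pseries_diffs_coef B A i j :
  pseries_diffs (coef B A i j) = coef (B *m A) A i j.
Proof.
apply/funext => k; rewrite /pseries_diffs /coef factS natrM invfM exprS.
by rewrite -[A * _]/(A *m _) mulmxA !mulrA mulfV ?pnatr_eq0// mul1r.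
Qed.

Lemma exprmxZ t A k : (t *: A) ^+ k = t ^+ k *: A ^+ k.
Proof.
elim: k => [|k IH]; first by rewrite !expr0 scale1r.
rewrite !exprS IH -[LHS]/((t *: A) *m (t ^+ k *: A ^+ k)).
by rewrite -scalemxAl -scalemxAr scalerA.
Qed.

Lemma mul_series_mexp B A t i j k :
  (B *m series (fun k => k`!%:R^-1 *: (t *: A) ^+ k) k) i j =
  pseries (coef B A i j) t k.
Proof.
rewrite /pseries /series /= mulmx_sumr summxE; apply: eq_bigr => l _.
by rewrite exprmxZ -2!scalemxAr mxE [X in _ * X]mxE /coef mulrCA mulrC.
Qed.

Lemma cvg_mexp A :
  series (fun k => k`!%:R^-1 *: A ^+ k) @ \oo --> mexp A.
Proof.
apply/cvg_ex; exists (\matrix_(i, j) limn (pseries (coef 1%:M A i j) 1)).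
apply/cvg_mxP => i j; rewrite mxE.
have := @is_cvg_coef 1%:M A i j 1; apply: cvg_trans.
rewrite (_ : (fun _ => _) = pseries (coef 1%:M A i j) 1)//.
by apply/funext => k; rewrite -mul_series_mexp scale1r mul1mx.
Qed.

Lemma lim_pseries_coef B A t i j :
  limn (pseries (coef B A i j) t) = (B *m mexp (t *: A)) i j.
Proof.
apply: cvg_lim => //.
have /cvg_mxP/(_ i j) :
    (fun k => B *m series (fun k => k`!%:R^-1 *: (t *: A) ^+ k) k) @ \oo -->
    B *m mexp (t *: A).
  by apply: cvg_mulmx; [exact: cvg_cst|exact: cvg_mexp].
apply: cvg_trans; rewrite (_ : (fun _ => _) = pseries (coef B A i j) t)//.
by apply/funext => k; rewrite -mul_series_mexp.
Qed.

(** Each entry is a power series with infinite radius of convergence, hence can be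
    differentiated term by term. *)
Lemma is_derive_mexp A t :
  is_derive t (1 : R) (fun s => mexp (s *: A)) (A *m mexp (t *: A)).
Proof.
apply/is_derive_mxP => i j; rewrite -lim_pseries_coef.
rewrite (_ : (fun _ => _) = fun s => limn (pseries (coef 1%:M A i j) s)).
  rewrite -{2}[A]mul1mx -pseries_diffs_coef.
  (* Any radius larger than |t| will do. *)
  apply: (@pseries_snd_diffs _ _ (`|t| + 1)); rewrite ?pseries_diffs_coef.
  - exact: is_cvg_coef.
  - exact: is_cvg_coef.
  - exact: is_cvg_coef.
  - by rewrite [ltRHS]ger0_norm ?ltrDl// addr_ge0.
by apply/funext => s; rewrite lim_pseries_coef mul1mx.
Qed.

(** A commutes with every partial sum of the series of B, hence with the limit. *)
Lemma mexp_comm A B : A *m B = B *m A -> A *m mexp B = mexp B *m A.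
Proof.
move=> AB.
apply: (@cvg_unique _ _
  ((fun k => A *m series (fun k => k`!%:R^-1 *: B ^+ k) k) @ \oo)).
- exact: norm_hausdorff.
- by apply: cvg_mulmx; [exact: cvg_cst|exact: cvg_mexp].
rewrite (_ : (fun _ => _) =
    (fun k => series (fun k => k`!%:R^-1 *: B ^+ k) k *m A)).
  by apply: cvg_mulmx; [exact: cvg_mexp|exact: cvg_cst].
apply/funext => k; rewrite /series /= mulmx_sumr mulmx_suml.
apply: eq_bigr => l _; rewrite -scalemxAr -scalemxAl; congr (_ *: _).
exact: (commrX l (AB : GRing.comm A B)).
Qed.

Lemma mexp0 : mexp (0 : 'M[R]_n) = 1%:M.
Proof.
apply: lim_near_cst; first exact: norm_hausdorff.
near=> k; rewrite /series /= -[k]prednK ?big_nat_recl//=; last by near: k.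
rewrite big1 ?addr0 ?expr0 ?invr1 ?scale1r// => i _.
by rewrite exprS mul0r scaler0.
Unshelve. all: by end_near. Qed.

Lemma trmx_mexp A : (mexp A)^T = mexp A^T.
Proof.
apply/esym/cvg_lim; first exact: norm_hausdorff.
apply/cvg_mxP => i j; rewrite mxE.
have /cvg_mxP/(_ j i) := @cvg_mexp A; apply: cvg_trans.
rewrite [X in X @ _](_ : _ =
   (fun k => series (fun k => k`!%:R^-1 *: A ^+ k) k j i))//.
apply/funext => k; rewrite /series /= !summxE; apply: eq_bigr => l _.
rewrite !mxE; congr (_ * _).
elim: l i j => [|l IH] i j; first by rewrite !expr0 !mxE eq_sym.
rewrite exprS exprSr !mxE; apply: eq_bigr => h _.
by rewrite IH mxE mulrC.
Qed.
End mexp.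

(** The mean value theorem applied to each entry.  All uniqueness statements for
    differential equations below come down to this lemma, through a well-chosen
    integrating factor. *)
Lemma is_derive_cst_interval (R : realType) m n (I : set R)
    (f : R -> 'M[R]_(m, n)) :
  is_interval I -> (forall t, I t -> is_derive t (1 : R) f 0) ->
  forall s t, I s -> I t -> f s = f t.
Proof.
move=> itvI df.
suff lt_cst s t : s < t -> I s -> I t -> f s = f t.
  move=> s t Is It; have [st|ts|->//] := ltgtP s t; first exact: lt_cst.
  by rewrite (lt_cst t s).
move=> st Is It; apply/matrixP => i j.
have dfij x : s <= x <= t -> is_derive x (1 : R) (fun x => f x i j) 0.
  move=> sxt; have /is_derive_mxP/(_ i j) := df x (itvI s t Is It x sxt).
  by rewrite mxE.
have [x||c _] := @MVT R (fun x => f x i j) (fun=> 0) s t st.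
- by rewrite in_itv /= => /andP[sx xt]; apply: dfij; rewrite !ltW.
- apply: derivable_within_continuous => x; rewrite in_itv /= => sxt.
  by have [] := dfij x sxt.
by rewrite mul0r => /eqP; rewrite subr_eq0 => /eqP.
Qed.

(* Only the differential and algebraic laws of the exponential matter from here
   on, not its series. *)
Local Opaque mexp.

Section mexp_group.
Variables (R : realType) (n : nat).
Implicit Types (A B : 'M[R]_n) (t : R).

Lemma mexpZ_comm A t : A *m mexp (t *: A) = mexp (t *: A) *m A.
Proof. by apply: mexp_comm; rewrite -scalemxAr -scalemxAl. Qed.

(** The product e^(tA) e^(-tA) has zero derivative and equals 1 at t = 0. *)
Lemma mexpKN A : mexp A *m mexp (- A) = 1%:M.
Proof.
suff H s t : mexp (s *: A) *m mexp (s *: - A) = mexp (t *: A) *m mexp (t *: - A).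
  by have := H 1 0; rewrite !scale1r !scale0r mexp0 mulmx1.
apply: (@is_derive_cst_interval _ _ _ setT
  (fun s => mexp (s *: A) *m mexp (s *: - A))) => // {s t}t _.
apply: (is_derive_eq (is_derive_mulmx (is_derive_mexp _ _) (is_derive_mexp _ _))).
by rewrite mexpZ_comm mulNmx mulmxN mulmxA subrr.
Qed.

Lemma mexpNK A : mexp (- A) *m mexp A = 1%:M.
Proof. by have := mexpKN (- A); rewrite opprK. Qed.

Lemma mexp_unitmx A : mexp A \in unitmx.
Proof. by have [] := mulmx1_unit (mexpKN A). Qed.

Lemma mexp_sqr A : mexp A *m mexp A = mexp (2 *: A).
Proof.
(* The product e^(tA) e^(tA) e^(-2tA) is constant. *)
suff H s t : mexp (s *: A) *m mexp (s *: A) *m mexp (s *: - (2 *: A)) =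
             mexp (t *: A) *m mexp (t *: A) *m mexp (t *: - (2 *: A)).
  have := H 1 0; rewrite !scale1r !scale0r mexp0 !mulmx1.
  move=> /(congr1 (fun M => M *m mexp (2 *: A))).
  by rewrite -mulmxA (mexpNK (2 *: A)) mul1mx mulmx1.
apply: (@is_derive_cst_interval _ _ _ setT
  (fun s => mexp (s *: A) *m mexp (s *: A) *m mexp (s *: - (2 *: A)))) => // {s t}t _.
apply: (is_derive_eq (is_derive_mulmx (is_derive_mulmx
  (is_derive_mexp _ _) (is_derive_mexp _ _)) (is_derive_mexp _ _))).
have := mexpZ_comm A t; set e := mexp (t *: A); set f := mexp _ => Ae.
rewrite -[2 *: A]/((1 + 1) *: A) scalerDl scale1r mulNmx mulmxN.
rewrite mulmxDl !mulmxDl mulmxDr.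
rewrite !Ae !mulmxA.
by rewrite -(mulmxA e A e) Ae !mulmxA subrr.
Qed.

(** The determinant is the square of that of e^(A/2), which is invertible. *)
Lemma det_mexp_gt0 A : 0 < \det (mexp A).
Proof.
rewrite -[A](@scalerKV _ _ 2)// -mexp_sqr det_mulmx -expr2.
by rewrite exprn_even_gt0//= -unitfE -unitmxE mexp_unitmx.
Qed.

(** Every derivative of e^(tA) is a constant matrix times e^(tA). *)
Lemma Ck_mexp A (U : set R) k : open U -> Ck U k (fun t => mexp (t *: A)).
Proof.
move=> openU; have dE t : differentiable (fun t => mexp (t *: A)) t.
  by apply/derivable1_diffP; have [] := is_derive_mexp A t.
elim: k => [|k IH] /=; first by move=> t _; exact/differentiable_continuous.
split=> [//|v].
rewrite (_ : 'D_v _ = fun t => v *: (A *m mexp (t *: A))).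
  apply: CkZ => //; first exact: Ck_cst.
  by apply: Ck_mulmx => //; exact: Ck_cst.
apply/funext => t; rewrite deriveE// -[v in LHS]mulr1.
rewrite -[v * 1]/(v *: (1 : R)) linearZ /= -deriveE//; congr (_ *: _).
exact: (@derive_val _ _ _ _ _ _ _ (is_derive_mexp A t)).
Qed.
End mexp_group.

(** * The metric on the Lie algebra *)

(** The polarization of [qform], expressed by the traces of A B and A B^T instead
    of the symmetric and skew parts: in this form both transposition and cyclic
    rotation can be used. *)
Definition metric_form (R : realType) n (beta : R) (A B : 'M[R]_n) : R :=
  (1 - beta) / 2 * \tr (A *m B) + (1 + beta) / 2 * \tr (A *m B^T).

(** [Gamma] at the identity; left translation recovers it at any other point. *)
Definition body_Gamma (R : realType) n (beta : R) (A B : 'M[R]_n) : 'M[R]_n :=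
  - (2^-1 *: (A *m B + B *m A)) + ((1 + beta) / 4) *: (mcomm A B^T + mcomm B A^T).

Section metric_form.
Variables (R : realType) (n : nat) (beta : R).
Implicit Types A B C y z w : 'M[R]_n.

Lemma tr_mskew2 A :
  \tr (mskew A *m mskew A) = 2^-1 * (\tr (A *m A) - \tr (A *m A^T)).
Proof.
rewrite /mskew -scalemxAl -scalemxAr scalerA mxtraceZ mulmxBl !mulmxBr !raddfB /=.
rewrite -trmx_mul mxtrace_tr (mxtrace_mulC A^T).
by field.
Qed.

Lemma tr_msym2 A :
  \tr (msym A *m msym A) = 2^-1 * (\tr (A *m A) + \tr (A *m A^T)).
Proof.
rewrite /msym -scalemxAl -scalemxAr scalerA mxtraceZ mulmxDl !mulmxDr !raddfD /=.
rewrite -trmx_mul mxtrace_tr (mxtrace_mulC A^T).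
by field.
Qed.

Lemma trmx_mskew A : (mskew A)^T = - mskew A.
Proof. by rewrite /mskew linearZ linearB /= trmxK -scalerN opprB. Qed.

Lemma qformE A : qform beta A =
  \tr (msym A *m msym A) + beta * \tr ((mskew A)^T *m mskew A).
Proof.
rewrite /qform trmx_mskew mulNmx raddfN /= tr_msym2 tr_mskew2.
by field.
Qed.

Lemma metric_formC A B : metric_form beta A B = metric_form beta B A.
Proof.
rewrite /metric_form mxtrace_mulC; congr (_ + _ * _).
by rewrite -[LHS]mxtrace_tr trmx_mul trmxK.
Qed.

Lemma metric_formDl A B C :
  metric_form beta (A + B) C = metric_form beta A C + metric_form beta B C.
Proof. by rewrite /metric_form !mulmxDl !mxtraceD; ring. Qed.

Lemma metric_formDr A B C :
  metric_form beta C (A + B) = metric_form beta C A + metric_form beta C B.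
Proof. by rewrite !(metric_formC C) metric_formDl. Qed.

Lemma metric_formBl A B C :
  metric_form beta (A - B) C = metric_form beta A C - metric_form beta B C.
Proof. by rewrite /metric_form !mulmxBl !raddfB /=; ring. Qed.

Lemma metric_formBr A B C :
  metric_form beta C (A - B) = metric_form beta C A - metric_form beta C B.
Proof. by rewrite !(metric_formC C) metric_formBl. Qed.

Lemma qform_metric_form A : qform beta A = metric_form beta A A.
Proof.
rewrite qformE trmx_mskew mulNmx raddfN /= tr_msym2 tr_mskew2 /metric_form.
by field.
Qed.

Lemma polarization_qform A B : polarization (qform beta) A B = metric_form beta A B.
Proof.
rewrite /polarization !qform_metric_form metric_formDl !metric_formDr.
by rewrite (metric_formC B A); field.
Qed.

(** The form is the trace of (p A + q A^T) B, so p A + q A^T = 0.  Adding the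
    transposed equation gives A + A^T = 0, as p + q = 1, and then (p - q) A = 0
    with p - q = - beta. *)
Lemma metric_form_nondeg A :
  beta != 0 -> (forall B, metric_form beta A B = 0) -> A = 0.
Proof.
move=> beta0 A0.
pose C := ((1 - beta) / 2) *: A^T + ((1 + beta) / 2) *: A.
have C0 : C = 0.
  apply/matrixP => i j; rewrite [RHS]mxE -(A0 (delta_mx i j)).
  have trd (D : 'M[R]_n) : \tr (D *m delta_mx i j) = D j i.
    rewrite /mxtrace (bigD1 j)//= big1 ?addr0 => [|k kj].
      rewrite mxE (bigD1 i)//= big1 ?addr0 => [|l li].
        by rewrite mxE !eqxx mulr1.
      by rewrite mxE (negPf li) mulr0.
    by rewrite mxE big1 // => l _; rewrite mxE (negPf kj) andbF mulr0.
  have trd' (D : 'M[R]_n) : \tr (D *m (delta_mx i j)^T) = D i j.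
    by rewrite -[LHS]mxtrace_tr trmx_mul trmxK mxtrace_mulC trd mxE.
  by rewrite /metric_form trd trd' !mxE.
apply/matrixP => i j; rewrite [RHS]mxE.
have := congr1 (fun M : 'M[R]_n => M i j) C0.
have := congr1 (fun M : 'M[R]_n => M j i) C0.
rewrite /C !mxE => e1 e2.
have e3 : A i j + A j i = 0.
  by rewrite -[RHS]addr0 -{1}e1 -{1}e2; field.
apply/(mulfI beta0)/eqP; rewrite mulr0; apply/eqP.
move: e2; rewrite (_ : A j i = - A i j); last by apply/eqP; rewrite -addr_eq0 addrC e3.
by move=> <-; field.
Qed.

(** Metric compatibility at the identity, for left-translated vectors: the map
    z |-> y z + [body_Gamma] y z is skew-adjoint for the form. *)
Lemma metric_form_Gamma y z w :
  metric_form beta (y *m z + body_Gamma beta y z) w +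
  metric_form beta z (y *m w + body_Gamma beta y w) = 0.
Proof.
have rot (a b c : 'M[R]_n) : \tr (a *m b *m c) = \tr (b *m c *m a).
  by rewrite -mulmxA mxtrace_mulC.
have flip (a b c : 'M[R]_n) : \tr (a *m b *m c) = \tr (c^T *m b^T *m a^T).
  by rewrite -[LHS]mxtrace_tr !trmx_mul mulmxA.
rewrite /metric_form /body_Gamma /mcomm.
have tD (a b : 'M[R]_n) : (a + b)^T = a^T + b^T by exact: linearD.
have tN (a : 'M[R]_n) : (- a)^T = - a^T by exact: linearN.
have tZ k (a : 'M[R]_n) : (k *: a)^T = k *: a^T by exact: linearZ.
have trN (a : 'M[R]_n) : \tr (- a) = - \tr a by exact: linearN.
rewrite !(tD, tN, tZ, trmx_mul, trmxK).
rewrite !(mulmxDl, mulmxDr, mulNmx, mulmxN) -!(scalemxAl, scalemxAr).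
rewrite !(mulmxDl, mulmxDr, mulNmx, mulmxN) !mulmxA.
rewrite !(mxtraceD, mxtraceZ, trN).
(* Bring every trace to the form tr(z _ _) with z not transposed. *)
rewrite (rot y z w) (rot y z w^T) (rot y^T z w) (rot y^T z w^T).
rewrite (flip y z^T w) (flip z^T y w) (flip y z^T w^T) (flip z^T y w^T) !trmxK.
rewrite (rot w^T z y^T) (rot w z y^T).
rewrite -!(rot z).
by field.
Qed.
End metric_form.

(** * The Levi-Civita connection *)

Section connection.
Variables (R : realType) (n : nat) (beta : R).
Implicit Types (A B X : 'M[R]_n) (Y Z W : 'M[R]_n -> 'M[R]_n).
Implicit Types nabla :
  ('M[R]_n -> 'M[R]_n) -> ('M[R]_n -> 'M[R]_n) -> 'M[R]_n -> 'M[R]_n.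

Lemma is_derive_metric_form (V : normedModType R) (f g : V -> 'M[R]_n) (x v : V)
    (df dg : 'M[R]_n) :
  is_derive x v f df -> is_derive x v g dg ->
  is_derive x v (fun y => metric_form beta (f y) (g y))
    (metric_form beta df (g x) + metric_form beta (f x) dg).
Proof.
move=> dfx dgx.
have d1 := is_derive_mxtrace (is_derive_mulmx dfx dgx).
have d2 := is_derive_mxtrace (is_derive_mulmx dfx (is_derive_trmx dgx)).
apply: (is_derive_eq (is_deriveD (is_deriveZ ((1 - beta) / 2) d1)
                                 (is_deriveZ ((1 + beta) / 2) d2))).
by rewrite /metric_form !mxtraceD /GRing.scale /=; ring.
Qed.

Lemma metricE X A B :
  metric beta X A B = metric_form beta (invmx X *m A) (invmx X *m B).
Proof. exact: polarization_qform. Qed.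

Lemma GammaE X A B : X \in unitmx ->
  Gamma beta X A B = X *m body_Gamma beta (invmx X *m A) (invmx X *m B).
Proof.
move=> uX; rewrite /Gamma /body_Gamma [RHS]mulmxDr mulmxN -!scalemxAr.
congr (- (_ *: _) + _).
by rewrite mulmxDr !mulmxA !mulmxV// !mul1mx.
Qed.

Lemma GammaC X A B : Gamma beta X A B = Gamma beta X B A.
Proof.
rewrite /Gamma [A *m _ *m _ + _]addrC; congr (_ + _ *: (_ *m _)).
exact: addrC.
Qed.

Lemma GammaDl X A B C :
  Gamma beta X (A + B) C = Gamma beta X A C + Gamma beta X B C.
Proof.
have trD (a b : 'M[R]_n) : (a + b)^T = a^T + b^T by exact: linearD.
rewrite /Gamma [RHS]addrACA; congr (_ + _).
  rewrite -opprD -scalerDr; congr (- (_ *: _)).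
  by rewrite [RHS]addrACA !mulmxDl mulmxDr.
rewrite -scalerDr -mulmxDr; congr (_ *: (_ *m _)).
rewrite [RHS]addrACA /mcomm mulmxDr trD; congr (_ + _).
  by rewrite mulmxDl mulmxDr opprD addrACA.
by rewrite mulmxDl mulmxDr opprD addrACA.
Qed.

Lemma GammaZl X (a : R) A B : Gamma beta X (a *: A) B = a *: Gamma beta X A B.
Proof.
have trZ (b : 'M[R]_n) : (a *: b)^T = a *: b^T by exact: linearZ.
rewrite /Gamma [RHS]scalerDr; congr (_ + _).
  rewrite scalerN scalerA [a * _]mulrC -scalerA; congr (- (_ *: _)).
  by rewrite scalerDr -!scalemxAl -scalemxAr.
rewrite [RHS]scalerA [a * _]mulrC -[RHS]scalerA; congr (_ *: _).
rewrite scalemxAr; congr (_ *m _).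
rewrite [RHS]scalerDr -[invmx X *m (a *: A)]scalemxAr /mcomm trZ !scalerBr.
by rewrite -!scalemxAl -!scalemxAr.
Qed.

Lemma Ck_Gamma k Y Z : Ck (@GLp R n) k Y -> Ck (@GLp R n) k Z ->
  Ck (@GLp R n) k (fun X => Gamma beta X (Y X) (Z X)).
Proof.
have oU := @open_GLp R n.
move=> CY CZ.
have Ci : Ck (@GLp R n) k (fun X => invmx X).
  by apply: Ck_invmx => //; [exact: GLp_unitmx|exact: Ck_id].
have CiY : Ck (@GLp R n) k (fun X => invmx X *m Y X) by exact: Ck_mulmx.
have CiZ : Ck (@GLp R n) k (fun X => invmx X *m Z X) by exact: Ck_mulmx.
apply: CkD => //.
  apply: CkN => //; apply: CkZ => //; first exact: Ck_cst.
  by apply: CkD => //; apply: Ck_mulmx => //; exact: Ck_mulmx.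
apply: CkZ => //; first exact: Ck_cst.
apply: Ck_mulmx => //; first exact: Ck_id.
by apply: CkD => //; apply: CkD => //; [|apply: CkN => //| |apply: CkN => //];
  apply: Ck_mulmx => //; exact: Ck_trmx.
Qed.

Lemma smooth_is_derive Y X v : GLp X -> smooth_on (@GLp R n) Y ->
  is_derive X v Y ('D_v Y X).
Proof. by move=> GX sY; exact: (Ck_is_derive v GX (sY 1%N)). Qed.

Lemma smooth_differentiable (W' : normedModType R) (Y : 'M[R]_n -> W') X :
  GLp X -> smooth_on (@GLp R n) Y -> differentiable Y X.
Proof. by move=> GX sY; have [dY _] := sY 1%N; exact: dY. Qed.

Lemma smooth_derivable (W' : normedModType R) (Y : 'M[R]_n -> W') X v :
  GLp X -> smooth_on (@GLp R n) Y -> derivable Y X v.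
Proof. by move=> GX sY; exact/diff_derivable/smooth_differentiable. Qed.

(** Leibniz rule for the pulled-back fields A^-1 Z and A^-1 W: the derivative of
    A^-1 contributes the terms y z and y w, and adding and subtracting Gamma leaves
    exactly the expression that [metric_form_Gamma] shows to vanish. *)
Lemma is_derive_metric Y Z W X v : GLp X ->
  smooth_on (@GLp R n) Z -> smooth_on (@GLp R n) W ->
  is_derive X v (fun A => metric beta A (Z A) (W A))
    (metric beta X ('D_v Z X + Gamma beta X v (Z X)) (W X) +
     metric beta X (Z X) ('D_v W X + Gamma beta X v (W X))).
Proof.
move=> GX sZ sW; have uX := GLp_unitmx GX.
have oU := @open_GLp R n.
have di : is_derive X v (fun A => invmx A) (- (invmx X *m v *m invmx X)).
  apply: (@is_derive_invmx _ _ _ oU n (fun A => A)) => //.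
  - exact: GLp_unitmx.
  - exact: Ck_id.
have dZ := is_derive_mulmx di (smooth_is_derive v GX sZ).
have dW := is_derive_mulmx di (smooth_is_derive v GX sW).
rewrite (_ : (fun _ => _) =
  (fun A => metric_form beta (invmx A *m Z A) (invmx A *m W A))); last first.
  by apply/funext => A; rewrite metricE.
apply: (is_derive_eq (is_derive_metric_form dZ dW)).
rewrite !metricE.
set z := invmx X *m Z X; set w := invmx X *m W X; set y := invmx X *m v.
(* Completes the derivative of A^-1 to a covariant derivative. *)
have split_d (c d : 'M[R]_n) :
    - (invmx X *m v *m invmx X) *m c + invmx X *m d =
    invmx X *m (d + Gamma beta X v c) -
    (y *m (invmx X *m c) + body_Gamma beta y (invmx X *m c)).
  rewrite GammaE// -/y [in RHS]mulmxDr mulKmx//.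
  by rewrite opprD addrACA subrr addr0 addrC mulNmx /y !mulmxA.
rewrite !split_d -/z -/w metric_formBl metric_formBr.
by have := metric_form_Gamma beta y z w => H; lra.
Qed.

Lemma christoffel_levi_civita nabla :
  given_by_christoffel nabla (Gamma beta) -> levi_civita (metric beta) nabla.
Proof.
have oU := @open_GLp R n.
move=> nablaE; split.
- split.
  + move=> Y Z sY sZ k.
    have : Ck (@GLp R n) k (fun X => 'D_(Y X) Z X + Gamma beta X (Y X) (Z X)).
      by apply: CkD => //; [exact: Ck_derive_along|exact: Ck_Gamma].
    by apply: Ck_ext => // X GX; rewrite nablaE.
  + move=> Y1 Y2 Z s1 s2 sZ X GX.
    rewrite !nablaE//; last by move=> k; exact: CkD.
    rewrite GammaDl [RHS]addrACA; congr (_ + _).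
    have dZ := smooth_differentiable GX sZ.
    by rewrite !(deriveE _ dZ) linearD.
  + move=> f Y Z sf sY sZ X GX.
    rewrite !nablaE//; last by move=> k; exact: CkZ.
    rewrite GammaZl [RHS]scalerDr; congr (_ + _).
    have dZ := smooth_differentiable GX sZ.
    by rewrite !(deriveE _ dZ) linearZ.
  + move=> Y Z1 Z2 sY s1 s2 X GX.
    rewrite !nablaE//; last by move=> k; exact: CkD.
    rewrite (GammaC _ (Y X)) GammaDl -!(GammaC _ (Y X)) [RHS]addrACA; congr (_ + _).
    by rewrite [LHS](@deriveD _ _ _ Z1 Z2)//; exact: smooth_derivable.
  + move=> f Y Z sf sY sZ X GX.
    rewrite !nablaE//; last by move=> k; exact: CkZ.
    rewrite (GammaC _ (Y X)) GammaZl -(GammaC _ (Y X)) [in RHS]scalerDr addrA.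
    congr (_ + _).
    have df := @smooth_derivable _ f X (Y X) GX sf.
    have dZ := @smooth_is_derive Z X (Y X) GX sZ.
    apply/matrixP => i j; rewrite derive_mxE; last first.
      by apply: smooth_derivable => // k; exact: CkZ.
    rewrite (_ : (fun _ => _) = f * (fun A => Z A i j)); last first.
      by apply/funext => A; rewrite mxE.
    have /is_derive_mxP/(_ i j) [dZij dZijE] := dZ.
    rewrite deriveM// dZijE !mxE addrC; congr (_ + _).
    exact: mulrC.
- move=> Y Z sY sZ X GX; rewrite !nablaE// GammaC.
  by rewrite opprD addrACA subrr addr0.
- move=> Y Z W sY sZ sW X GX; rewrite !nablaE//.
  exact: (@derive_val _ _ _ _ _ _ _ (is_derive_metric _ _ GX sZ sW)).
Qed.

(** Let D be the difference of the connections.  T Y Z W = g (D Y Z) W is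
    symmetric in Y, Z by torsion-freeness and antisymmetric in Z, W by metric
    compatibility, hence zero; the fields W with W X = X B for arbitrary B then
    separate tangent vectors at X. *)
Lemma levi_civita_unique nabla nabla' Y Z X : beta != 0 ->
  levi_civita (metric beta) nabla -> levi_civita (metric beta) nabla' ->
  smooth_on (@GLp R n) Y -> smooth_on (@GLp R n) Z -> GLp X ->
  nabla Y Z X = nabla' Y Z X.
Proof.
move=> beta0 [_ tn mn] [_ tn' mn'] sY sZ GX; have uX := GLp_unitmx GX.
pose D Y Z := nabla Y Z X - nabla' Y Z X.
pose T Y Z W := metric_form beta (invmx X *m D Y Z) (invmx X *m W X).
pose s W := smooth_on (@GLp R n) W.
have DC Y1 Z1 : s Y1 -> s Z1 -> D Y1 Z1 = D Z1 Y1.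
  move=> s1 s2; have := tn' _ _ s1 s2 X GX; rewrite -(tn _ _ s1 s2 X GX).
  move=> /matrixP E; apply/matrixP => i j; move: (E i j).
  by rewrite /D !mxE => Eij; lra.
have TN Y1 Z1 W1 : s Y1 -> s Z1 -> s W1 -> T Y1 Z1 W1 = - T Y1 W1 Z1.
  move=> s1 s2 s3; have := mn' _ _ _ s1 s2 s3 X GX.
  rewrite (mn _ _ _ s1 s2 s3 X GX) !metricE /T /D !mulmxBr !metric_formBl.
  rewrite -!(metric_formC _ (invmx X *m Z1 X)) => E.
  by rewrite -[RHS]addr0; lra.
have T0 W : s W -> T Y Z W = 0.
  move=> sW; suff : T Y Z W = - T Y Z W by lra.
  rewrite {1}TN// {1}/T DC// -/(T _ _ _) TN// opprK {1}/T DC// -/(T _ _ _) TN//.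
  by rewrite {1}/T DC.
have D0 : invmx X *m D Y Z = 0.
  apply: (metric_form_nondeg beta0) => B.
  have := T0 (fun=> X *m B) (fun k => Ck_cst _ k (X *m B)).
  by rewrite /T mulKmx.
apply/subr0_eq; rewrite -/(D Y Z).
by rewrite -[D Y Z](mulKVmx uX) D0 mulmx0.
Qed.

Lemma levi_civita_christoffel nabla : beta != 0 ->
  levi_civita (metric beta) nabla -> given_by_christoffel nabla (Gamma beta).
Proof.
move=> beta0 LC Y Z sY sZ X GX.
apply: (@levi_civita_unique nabla
  (fun Y Z X => 'D_(Y X) Z X + Gamma beta X (Y X) (Z X))) => //.
exact: christoffel_levi_civita.
Qed.
End connection.

(** * Geodesics *)

(** The covariant derivative of a left-invariant field along another one, pulled
    back to the identity. *)
Definition body_connection (R : realType) n (beta : R)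
    (A B : 'M[R]_n) : 'M[R]_n :=
  A *m B + body_Gamma beta A B.

Section trivialization.
Variables (R : realType) (n : nat) (beta : R) (V : 'M[R]_n).
Implicit Types (A B X u v : 'M[R]_n) (t : R).

(** The two generators of the geodesic X e^(t left_gen) e^(t right_gen). *)
Definition left_gen : 'M[R]_n := 2^-1 *: ((1 - beta) *: V + (1 + beta) *: V^T).
Definition right_gen : 'M[R]_n := (1 + beta) *: mskew V.

Lemma left_gen_add_right_gen : left_gen + right_gen = V.
Proof.
by rewrite /left_gen /right_gen /mskew; apply/matrixP => i j; rewrite !mxE; field.
Qed.

Lemma trmx_right_gen : right_gen^T = - right_gen.
Proof. by rewrite /right_gen linearZ /= trmx_mskew scalerN. Qed.

Lemma geodE X t :
  geod beta X V t = X *m mexp (t *: left_gen) *m mexp (t *: right_gen).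
Proof. by rewrite /geod /left_gen /right_gen !scalerA. Qed.

Lemma body_connectionE A B : body_connection beta A B = 2^-1 *: mcomm A B
  + ((1 + beta) / 4) *: (mcomm A B^T + mcomm B A^T).
Proof.
rewrite /body_connection /body_Gamma addrA; congr (_ + _); rewrite /mcomm.
by move: (A *m B) (B *m A) => P Q; apply/matrixP => i j; rewrite !mxE; field.
Qed.

Lemma body_connection_diag A :
  body_connection beta A A = ((1 + beta) / 2) *: mcomm A A^T.
Proof.
rewrite body_connectionE /mcomm subrr scaler0 add0r.
by move: (_ - _) => P; apply/matrixP => i j; rewrite !mxE; field.
Qed.

Lemma trmx_body_connection_diag A :
  (body_connection beta A A)^T = body_connection beta A A.
Proof.
by rewrite body_connection_diag /mcomm linearZ /= linearB /= !trmx_mul trmxK.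
Qed.

(** P combines the left-trivialized connection along V with the rotation of the
    frame e^(t right_gen). *)
Lemma Pop_body_connection B :
  Pop beta V B = - body_connection beta V B - mcomm B right_gen.
Proof.
rewrite body_connectionE /Pop /right_gen /mcomm /mskew.
rewrite -!(scalemxAl, scalemxAr) !(mulmxBl, mulmxBr).
move: (B *m V) (V *m B) (B *m V^T) (V^T *m B) (B^T *m V) (V *m B^T).
by move=> P1 P2 P3 P4 P5 P6; apply/matrixP => i j; rewrite !mxE; field.
Qed.

(** Conjugation by an orthogonal matrix is an algebra automorphism that commutes
    with transposition, and the connection is built from these operations. *)
Lemma body_connection_conj (e e' : 'M[R]_n) A B : e^T = e' -> e *m e' = 1%:M ->
  body_connection beta (e' *m A *m e) (e' *m B *m e) =
  e' *m body_connection beta A B *m e.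
Proof.
move=> eT ee'; pose cj (M : 'M[R]_n) := e' *m M *m e.
have cjD a b : cj (a + b) = cj a + cj b by rewrite /cj mulmxDr mulmxDl.
have cjN a : cj (- a) = - cj a by rewrite /cj mulmxN mulNmx.
have cjZ k a : cj (k *: a) = k *: cj a by rewrite /cj -scalemxAr -scalemxAl.
have cjM a b : cj (a *m b) = cj a *m cj b.
  by rewrite /cj !mulmxA -(mulmxA _ e e') ee' mulmx1.
have cjT a : cj a^T = (cj a)^T by rewrite /cj !trmx_mul -eT trmxK mulmxA.
rewrite -/(cj A) -/(cj B) -/(cj (body_connection _ _ _)).
rewrite /body_connection /body_Gamma /mcomm.
by rewrite !(cjD, cjN, cjZ, cjM, cjT).
Qed.

Lemma trmx_mexp_right_gen t : (mexp (t *: right_gen))^T = mexp (- (t *: right_gen)).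
Proof.
rewrite trmx_mexp; congr mexp.
by rewrite linearZ /= trmx_right_gen scalerN.
Qed.

(** The left-trivialized velocity of the geodesic, g^-1 g'. *)
Definition body_velocity t : 'M[R]_n :=
  mexp (- (t *: right_gen)) *m V *m mexp (t *: right_gen).

Lemma is_derive_mexpN A t :
  is_derive t (1 : R) (fun s => mexp (- (s *: A))) (- (A *m mexp (- (t *: A)))).
Proof.
have := is_derive_mexp (- A) t; rewrite scalerN mulNmx.
by rewrite (_ : (fun s => mexp (s *: - A)) = (fun s => mexp (- (s *: A))))//;
  apply/funext => s; rewrite scalerN.
Qed.

Lemma mexpNZ_comm A t : A *m mexp (- (t *: A)) = mexp (- (t *: A)) *m A.
Proof. by apply: mexp_comm; rewrite mulmxN mulNmx -scalemxAr -scalemxAl. Qed.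

(** This is where left_gen + right_gen = V enters: the derivative inserts the sum
    of the two generators between the two exponentials. *)
Lemma is_derive_geod X t : is_derive t (1 : R) (geod beta X V)
  (geod beta X V t *m body_velocity t).
Proof.
rewrite (_ : geod beta X V =
  (fun s => X *m mexp (s *: left_gen) *m mexp (s *: right_gen))); last first.
  by apply/funext => s; rewrite geodE.
have d := is_derive_mulmx (is_derive_mulmxl X (is_derive_mexp left_gen t))
  (is_derive_mexp right_gen t).
apply: (is_derive_eq d).
have := mexpKN (t *: right_gen); rewrite /body_velocity mexpZ_comm.
move: (mexp (t *: left_gen)) (mexp (t *: right_gen)) (mexp (- _)) => E F F' FF'.
rewrite !mulmxA -(mulmxA _ F F') FF' mulmx1 -[in RHS]left_gen_add_right_gen mulmxDr.
by rewrite mulmxDl.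
Qed.

Lemma GLp_geod X t : GLp X -> GLp (geod beta X V t).
Proof.
by rewrite /GLp /= geodE !det_mulmx => X0; rewrite !mulr_gt0// det_mexp_gt0.
Qed.

Lemma Ck_geod X (U : set R) k : open U -> Ck U k (geod beta X V).
Proof.
move=> oU.
have : Ck U k (fun s => X *m mexp (s *: left_gen) *m mexp (s *: right_gen)).
  apply: Ck_mulmx => //; last exact: Ck_mexp.
  by apply: Ck_mulmx => //; [exact: Ck_cst|exact: Ck_mexp].
by apply: Ck_ext => [//|t _]; exact/esym/geodE.
Qed.
End trivialization.

Section motion.
Variables (R : realType) (n : nat) (beta : R).
Hypothesis beta0 : beta != 0.
Variable nabla :
  ('M[R]_n -> 'M[R]_n) -> ('M[R]_n -> 'M[R]_n) -> 'M[R]_n -> 'M[R]_n.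
Hypothesis LC : levi_civita (metric beta) nabla.
Implicit Types (A B X V u v : 'M[R]_n) (t : R) (I : set R) (c W : R -> 'M[R]_n).

Lemma christoffelE X A B : GLp X -> christoffel nabla X A B = Gamma beta X A B.
Proof.
move=> GX; rewrite /christoffel (levi_civita_christoffel beta0 LC)//.
- by rewrite derive_cst add0r.
- by move=> k; exact: Ck_cst.
- by move=> k; exact: Ck_cst.
Qed.

(** If c' = c v, then covariant differentiation along c acts on fields c u as
    u' + [body_connection] v u: the position of c disappears. *)
Lemma covariant_derivative_body c (u : R -> 'M[R]_n) t v du :
  GLp (c t) -> is_derive t (1 : R) c (c t *m v) -> is_derive t (1 : R) u du ->
  covariant_derivative nabla c (fun s => c s *m u s) t =
  c t *m (du + body_connection beta v (u t)).
Proof.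
move=> Gc dc du_; have uc := GLp_unitmx Gc.
rewrite /covariant_derivative christoffelE// !derive1E.
rewrite (@derive_val _ _ _ _ _ _ _ dc).
rewrite (@derive_val _ _ _ _ _ _ _ (is_derive_mulmx dc du_)).
rewrite GammaE// !mulKmx// -mulmxA -!mulmxDr; congr (_ *m _).
by rewrite /body_connection [RHS]addrA [du + _]addrC.
Qed.

Lemma is_derive_ext I (f g : R -> 'M[R]_n) t df : open I -> I t ->
  (forall s, I s -> f s = g s) ->
  is_derive t (1 : R) f df -> is_derive t (1 : R) g df.
Proof.
move=> oI It fg; apply: near_eq_is_derive.
by near=> s; apply: fg; near: s; exact: open_nbhs_nbhs.
Unshelve. all: by end_near. Qed.

Lemma covariant_derivative_ext I c W W' t : open I -> I t ->
  (forall s, I s -> W s = W' s) ->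
  covariant_derivative nabla c W t = covariant_derivative nabla c W' t.
Proof.
move=> oI It WW'; rewrite /covariant_derivative (WW' t It) !derive1E.
rewrite (@near_eq_derive _ _ _ W W')//.
by near=> s; apply: WW'; near: s; exact: open_nbhs_nbhs.
Unshelve. all: by end_near. Qed.

Lemma Ck_derive1 I k c : Ck I k.+1 c -> Ck I k (derive1 c).
Proof.
move=> [_ /(_ 1)]; have -> : derive1 c = 'D_1 c; last by [].
by apply/funext => t; exact: derive1E.
Qed.

Lemma smooth_is_derive1 I c t : I t -> smooth_on I c ->
  is_derive t (1 : R) c (derive1 c t).
Proof. by move=> It sc; rewrite derive1E; exact: Ck_is_derive It (sc 1%N). Qed.

(** Rewrites the quadratic right-hand side of the geodesic equation w' = - q [w, w^T]
    as the commutator with q (w - w^T), a conserved quantity. *)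
Lemma Euler_skew A :
  mcomm A (((1 + beta) / 2) *: (A - A^T)) = - body_connection beta A A.
Proof.
rewrite body_connection_diag /mcomm -scalemxAr -scalemxAl mulmxBr mulmxBl.
move: (A *m A) (A *m A^T) (A^T *m A) => P Q Q'.
by apply/matrixP => i j; rewrite !mxE; ring.
Qed.

(** The skew part of V commutes with [right_gen], a multiple of it, so the
    conjugation in [body_velocity] does not change it. *)
Lemma body_velocity_skew V t :
  ((1 + beta) / 2) *: (body_velocity beta V t - (body_velocity beta V t)^T) =
  right_gen beta V.
Proof.
have trN : (mexp (- (t *: right_gen beta V)))^T = mexp (t *: right_gen beta V).
  by rewrite -trmx_mexp_right_gen trmxK.
rewrite /body_velocity !trmx_mul trmx_mexp_right_gen trN mulmxA -mulmxBl -mulmxBr.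
rewrite scalemxAl scalemxAr.
rewrite (_ : _ *: (V - V^T) = right_gen beta V); last first.
  by rewrite /right_gen /mskew scalerA.
by rewrite -mulmxA mexpZ_comm mulmxA mexpNK mul1mx.
Qed.

Lemma is_derive_body_velocity V t :
  is_derive t (1 : R) (body_velocity beta V)
    (mcomm (body_velocity beta V t) (right_gen beta V)).
Proof.
have d := is_derive_mulmx (is_derive_mulmx (is_derive_mexpN (right_gen beta V) t)
  (is_derive_cst V t 1)) (is_derive_mexp (right_gen beta V) t).
apply: (is_derive_eq d); rewrite /body_velocity /mcomm mulmx0 addr0.
by rewrite mexpZ_comm !mulNmx !mulmxA addrC.
Qed.

Lemma body_velocity_Euler V t :
  mcomm (body_velocity beta V t) (right_gen beta V) +
  body_connection beta (body_velocity beta V t) (body_velocity beta V t) = 0.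
Proof. by rewrite -{1}(body_velocity_skew V t) Euler_skew addNr. Qed.

Lemma body_velocity0 V : body_velocity beta V 0 = V.
Proof. by rewrite /body_velocity scale0r oppr0 mexp0 mul1mx mulmx1. Qed.

Lemma geod0 X V : geod beta X V 0 = X.
Proof. by rewrite geodE !scale0r mexp0 !mulmx1. Qed.

Lemma eq_geod_geodesic I c X V : open I -> I 0 -> GLp X ->
  (forall t, I t -> c t = geod beta X V t) ->
  [/\ geodesic nabla I c, c 0 = X & derive1 c 0 = X *m V].
Proof.
move=> oI I0 GX cE.
have dc t : I t -> is_derive t (1 : R) c (c t *m body_velocity beta V t).
  move=> It; rewrite cE//; 
  apply: (is_derive_ext oI It _ (is_derive_geod beta V X t)) => s Is.
  by rewrite cE.
have c'E t : I t -> derive1 c t = c t *m body_velocity beta V t.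
  by move=> It; rewrite derive1E; exact: (@derive_val _ _ _ _ _ _ _ (dc t It)).
split; last 2 first.
- by rewrite cE// geod0.
- by rewrite c'E// cE// geod0 body_velocity0.
split.
- move=> k; have := @Ck_geod _ _ beta V X I k oI; apply: Ck_ext => // t It.
  by rewrite cE.
- by move=> t It; rewrite cE//; exact: GLp_geod.
move=> t It; rewrite (@covariant_derivative_ext I _ _ _ _ oI It c'E).
rewrite (covariant_derivative_body _ (dc t It) (is_derive_body_velocity V t)).
  by rewrite body_velocity_Euler mulmx0.
by rewrite cE//; exact: GLp_geod.
Qed.

(** Three successive constants of motion: the skew part of the left-trivialized
    velocity w, then e^(tS) w e^(-tS), then c e^(-tS) e^(-tA). *)
Lemma geodesic_eq_geod I c X V : open I -> is_interval I -> I 0 -> GLp X ->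
  geodesic nabla I c -> c 0 = X -> derive1 c 0 = X *m V ->
  forall t, I t -> c t = geod beta X V t.
Proof.
move=> oI itvI I0 GX [sc Gc geo] c0 c'0.
have uc t : I t -> c t \in unitmx by move=> It; exact/GLp_unitmx/Gc.
pose w t := invmx (c t) *m derive1 c t.
have sw : smooth_on I w.
  move=> k; apply: Ck_mulmx => //; first exact: Ck_invmx.
  exact: Ck_derive1.
have c'E t : I t -> derive1 c t = c t *m w t by move=> It; rewrite mulKVmx// uc.
have dc t : I t -> is_derive t (1 : R) c (c t *m w t).
  by move=> It; rewrite -(c'E t It); exact: smooth_is_derive1 It sc.
have dw t : I t -> is_derive t (1 : R) w (- body_connection beta (w t) (w t)).
  move=> It; have d := smooth_is_derive1 It sw; apply: (is_derive_eq d).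
  apply/eqP; rewrite -addr_eq0; apply/eqP.
  have := geo t It; rewrite (@covariant_derivative_ext I _ _ _ _ oI It c'E).
  rewrite (covariant_derivative_body (Gc t It) (dc t It) d) => E.
  by rewrite -[LHS](mulKmx (uc t It)) E mulmx0.
have w0 : w 0 = V by rewrite /w c'0 c0 mulKmx// GLp_unitmx.
(* The skew part of w is conserved. *)
have skew_w t : I t -> ((1 + beta) / 2) *: (w t - (w t)^T) = right_gen beta V.
  move=> It; have := body_velocity_skew V 0; rewrite body_velocity0 => <-.
  suff -> : w t - (w t)^T = V - V^T by [].
  rewrite -[V in RHS]w0.
  apply: (@is_derive_cst_interval _ _ _ I
    (fun s => w s - (w s)^T) itvI _ t 0 It I0).
  move=> s Is.
  have d := is_deriveB (dw s Is) (is_derive_trmx (dw s Is)).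
  by apply: (is_derive_eq d); rewrite linearN /= trmx_body_connection_diag subrr.
(* The equation for w is now linear; integrate it. *)
have wE t : I t -> w t = body_velocity beta V t.
  move=> It; set S := right_gen beta V in skew_w *.
  have E : mexp (t *: S) *m w t *m mexp (- (t *: S)) = V.
    rewrite -[RHS]w0.
    have -> : w 0 = mexp (0 *: S) *m w 0 *m mexp (- (0 *: S)).
      by rewrite scale0r oppr0 mexp0 mul1mx mulmx1.
    apply: (@is_derive_cst_interval _ _ _ I
      (fun t => mexp (t *: S) *m w t *m mexp (- (t *: S))) itvI) It I0 => s Is.
    have d := is_derive_mulmx (is_derive_mulmx (is_derive_mexp S s) (dw s Is))
      (is_derive_mexpN S s).
    apply: (is_derive_eq d); rewrite -Euler_skew skew_w// mexpZ_comm /mcomm.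
    move: (mexp _) (mexp _) (w s) => e e' x.
    rewrite mulmxN mulmxBr mulmxDl mulmxBl !mulmxA.
    by rewrite [X in X - _]addrC subrK subrr.
  rewrite /body_velocity -[X in _ *m X *m _]E -/S !mulmxA (mexpNK (t *: S)) mul1mx.
  by rewrite -mulmxA (mexpNK (t *: S)) mulmx1.
move=> t It; rewrite geodE; set S := right_gen beta V; set A := left_gen beta V.
have E : c t *m mexp (- (t *: S)) *m mexp (- (t *: A)) = X.
  have <- : c 0 *m mexp (- (0 *: S)) *m mexp (- (0 *: A)) = X.
    by rewrite !scale0r oppr0 mexp0 !mulmx1.
  apply: (@is_derive_cst_interval _ _ _ I
    (fun t => c t *m mexp (- (t *: S)) *m mexp (- (t *: A))) itvI) It I0 => s Is.
  have d := is_derive_mulmx (is_derive_mulmx (dc s Is) (is_derive_mexpN S s))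
    (is_derive_mexpN A s).
  apply: (is_derive_eq d).
  have wV : w s *m mexp (- (s *: S)) = mexp (- (s *: S)) *m (A + S).
    rewrite left_gen_add_right_gen wE// /body_velocity -/S.
    by rewrite -(mulmxA _ (mexp (s *: S))) (mexpKN (s *: S)) mulmx1.
  rewrite -(mulmxA (c s) (w s)) wV (mexpNZ_comm S).
  move: (mexp _) (mexp _) (c s) => e e' x.
  by rewrite !mulmxN -mulmxBr -mulmxBr addrK !mulmxA subrr.
rewrite -E; move: (mexpNK (t *: A)) (mexpNK (t *: S)).
move: (mexp (- (t *: A))) (mexp (- (t *: S))) (mexp (t *: A)) (mexp (t *: S)).
move=> a' s' a s NA NS; rewrite -(mulmxA _ a') NA mulmx1.
by rewrite -mulmxA NS mulmx1.
Qed.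
End motion.

(** * Parallel transport *)

Section transport.
Variables (R : realType) (n : nat) (beta : R).
Hypothesis beta0 : beta != 0.
Variable nabla :
  ('M[R]_n -> 'M[R]_n) -> ('M[R]_n -> 'M[R]_n) -> 'M[R]_n -> 'M[R]_n.
Hypothesis LC : levi_civita (metric beta) nabla.
Variables (X V : 'M[R]_n).
Hypothesis GX : GLp X.

Let A := left_gen beta V.
Let S := right_gen beta V.
Let L := lin_mx (Pop beta V).

(** Moving frame along the geodesic: it adds to left translation the rotation by
    the orthogonal matrices e^(tS), which makes the transport equation autonomous. *)
Definition frame (B : R -> 'M[R]_n) t : 'M[R]_n :=
  X *m mexp (t *: A) *m B t *m mexp (t *: S).

Definition Pop_flow (B0 : 'M[R]_n) t : 'M[R]_n :=
  vec_mx (mxvec B0 *m mexp (t *: L)).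

Lemma lin_mxZ t : lin_mx (t \*: Pop beta V) = t *: L.
Proof.
apply/matrixP => i j; rewrite !mxE /=.
by rewrite linearZ /= mxE.
Qed.

Lemma transportE eta :
  transport beta X V eta = frame (Pop_flow (invmx X *m eta)).
Proof.
apply/funext => t; rewrite /frame /Pop_flow /transport /expv lin_mxZ.
by rewrite /A /S /left_gen /right_gen !scalerA.
Qed.

Lemma is_derive_Pop_flow B0 t :
  is_derive t (1 : R) (Pop_flow B0) (Pop beta V (Pop_flow B0 t)).
Proof.
have d := is_derive_vec_mx (is_derive_mulmxl (mxvec B0) (is_derive_mexp L t)).
apply: (is_derive_eq d).
by rewrite mexpZ_comm mulmxA -[mxvec B0 *m _]vec_mxK mul_vec_lin mxvecK.
Qed.

(** On vectorized matrices P acts by right multiplication by L, and e^(-tL) is an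
    integrating factor. *)
Lemma Pop_flow_unique (I : set R) B : is_interval I -> I 0 ->
  (forall t, I t -> is_derive t (1 : R) B (Pop beta V (B t))) ->
  forall t, I t -> B t = Pop_flow (B 0) t.
Proof.
move=> itvI I0 dB t It.
have E : mxvec (B t) *m mexp (- (t *: L)) = mxvec (B 0).
  have <- : mxvec (B 0) *m mexp (- (0 *: L)) = mxvec (B 0).
    by rewrite scale0r oppr0 mexp0 mulmx1.
  apply: (@is_derive_cst_interval _ _ _ I
    (fun t => mxvec (B t) *m mexp (- (t *: L))) itvI) It I0 => s Is.
  have d := is_derive_mulmx (is_derive_mxvec (dB s Is)) (is_derive_mexpN L s).
  by apply: (is_derive_eq d); rewrite -mul_vec_lin mulmxN mulmxA subrr.
by rewrite /Pop_flow -E -mulmxA (mexpNK (t *: L)) mulmx1 mxvecK.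
Qed.

Lemma frame_geod B t : frame B t =
  geod beta X V t *m (mexp (- (t *: S)) *m B t *m mexp (t *: S)).
Proof.
rewrite geodE -/A -/S /frame; move: (mexpKN (t *: S)).
move: (mexp (t *: A)) (mexp (t *: S)) (mexp (- (t *: S))) => a s s' ss'.
by rewrite !mulmxA -(mulmxA _ s) ss' mulmx1.
Qed.

(** In left-trivialized form the field is e^(-tS) B e^(tS); differentiating it
    gives the conjugate of B' + [B, S], and the connection term is the conjugate of
    the one at V and B.  Their sum is the conjugate of B' - P B. *)
Lemma covariant_derivative_frame B t dB : is_derive t (1 : R) B dB ->
  covariant_derivative nabla (geod beta X V) (frame B) t =
  frame (fun=> dB - Pop beta V (B t)) t.
Proof.
move=> dB_; rewrite frame_geod.
rewrite (_ : frame B = (fun s => geod beta X V s *m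
  (mexp (- (s *: S)) *m B s *m mexp (s *: S)))); last first.
  by apply/funext => s; exact: frame_geod.
have d := is_derive_mulmx (is_derive_mulmx (is_derive_mexpN S t) dB_)
  (is_derive_mexp S t).
have Gt := GLp_geod beta V t GX.
rewrite (covariant_derivative_body beta0 LC Gt (is_derive_geod beta V X t) d).
congr (_ *m _); rewrite /body_velocity -/S body_connection_conj; first last.
- exact: mexpKN.
- exact: trmx_mexp_right_gen.
rewrite Pop_body_connection -/S /mcomm mexpNZ_comm.
move: (mexp (- (t *: S))) (mexp (t *: S)) (B t) (body_connection beta V (B t)).
move=> e' e b C; rewrite !opprD !opprK.
rewrite !(mulmxBl, mulmxBr, mulmxDl, mulmxDr, mulmxN, mulNmx) !mulmxA.
move: (e' *m S *m b *m e) (e' *m dB *m e) (e' *m b *m S *m e) (e' *m C *m e).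
by move=> P1 P2 P3 P4; apply/matrixP => i j; rewrite !mxE; ring.
Qed.

Lemma frame_eq0 (M : 'M[R]_n) t : frame (fun=> M) t = 0 -> M = 0.
Proof.
rewrite /frame => M0.
have u1 : X *m mexp (t *: A) \in unitmx.
  by rewrite unitmx_mul GLp_unitmx// mexp_unitmx.
rewrite -[M](mulKmx u1) -[_ *m M](mulmxK (mexp_unitmx (t *: S))).
by rewrite M0 mul0mx mulmx0.
Qed.

Lemma Ck_frame (I : set R) k B : open I -> Ck I k B -> Ck I k (frame B).
Proof.
move=> oI CB; apply: Ck_mulmx => //; last exact: Ck_mexp.
apply: Ck_mulmx => //; apply: Ck_mulmx => //; last exact: Ck_mexp.
exact: Ck_cst.
Qed.

Lemma Ck_Pop_flow (I : set R) k B0 : open I -> Ck I k (Pop_flow B0).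
Proof.
move=> oI; apply/(Ck_mxP oI) => i j.
have : Ck I k (fun t => mxvec B0 *m mexp (t *: L)).
  by apply: Ck_mulmx => //; [exact: Ck_cst|exact: Ck_mexp].
move=> /(Ck_mxP oI)/(_ 0 (mxvec_index i j)).
by apply: Ck_ext => [//|t _]; rewrite /Pop_flow [RHS]mxE.
Qed.

(** Any field is a frame field, so a parallel one has coordinates solving B' = P B
    and is determined by its value at time 0. *)
Lemma parallel_transportP (I : set R) eta t zeta :
  open I -> is_interval I -> I 0 -> I t ->
  parallel_transport nabla I (geod beta X V) 0 t eta zeta <->
  zeta = transport beta X V eta t.
Proof.
move=> oI itvI I0 It; have uX := GLp_unitmx GX.
split=> [[W [[sW parW] W0 Wt]]|->].
  pose B t := mexp (- (t *: A)) *m (invmx X *m W t) *m mexp (- (t *: S)).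
  have WE : W = frame B.
    apply/funext => s; rewrite /frame /B.
    move: (mexpKN (s *: A)) (mexpNK (s *: S)).
    move: (mexp (s *: A)) (mexp (s *: S)) (mexp (- (s *: A))) (mexp (- (s *: S))).
    move=> a e a' e' aa' ee'; rewrite !mulmxA -(mulmxA X a) aa' mulmx1 mulmxV//.
    by rewrite mul1mx -mulmxA ee' mulmx1.
  have dB s : I s -> is_derive s (1 : R) B (Pop beta V (B s)).
    move=> Is; have dW := smooth_is_derive1 Is sW.
    have d := is_derive_mulmx (is_derive_mulmx (is_derive_mexpN A s)
      (is_derive_mulmxl (invmx X) dW)) (is_derive_mexpN S s).
    apply: (is_derive_eq d); apply/subr0_eq/(@frame_eq0 _ s).
    by have H := parW s Is; rewrite WE (covariant_derivative_frame d) in H.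
  rewrite -Wt [in LHS]WE transportE /frame (Pop_flow_unique itvI I0 dB It).
  by rewrite /B !scale0r oppr0 mexp0 W0 mul1mx mulmx1.
exists (transport beta X V eta); split=> //.
  split.
    by move=> k; rewrite transportE; apply: Ck_frame => //; exact: Ck_Pop_flow.
  move=> s Is; rewrite transportE (covariant_derivative_frame (is_derive_Pop_flow _ _)).
  by rewrite /frame subrr mulmx0 mul0mx.
by rewrite transportE /frame /Pop_flow !scale0r !mexp0 !mulmx1 mxvecK mulKVmx.
Qed.
End transport.

Theorem proposition4 (R : realType) (n : nat) (beta : R) (hbeta : beta != 0) :
  [/\ forall A : 'M[R]_n,
        qform beta A =
        \tr (msym A *m msym A) + beta * \tr ((mskew A)^T *m mskew A),
      forall nabla : ('M[R]_n -> 'M[R]_n) -> ('M[R]_n -> 'M[R]_n) ->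
                     'M[R]_n -> 'M[R]_n,
        levi_civita (metric beta) nabla <->
        given_by_christoffel nabla (Gamma beta),
      forall nabla : ('M[R]_n -> 'M[R]_n) -> ('M[R]_n -> 'M[R]_n) ->
                     'M[R]_n -> 'M[R]_n,
        levi_civita (metric beta) nabla ->
        forall (X V : 'M[R]_n) (I : set R),
          GLp X -> open I -> is_interval I -> I 0 ->
          forall c : R -> 'M[R]_n,
            [/\ geodesic nabla I c, c 0 = X & derive1 c 0 = X *m V] <->
            (forall t, I t -> c t = geod beta X V t)
    & forall nabla : ('M[R]_n -> 'M[R]_n) -> ('M[R]_n -> 'M[R]_n) ->
                     'M[R]_n -> 'M[R]_n,
        levi_civita (metric beta) nabla ->
        forall (X V : 'M[R]_n) (I : set R),
          GLp X -> open I -> is_interval I -> I 0 ->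
          forall (eta : 'M[R]_n) (t : R), I t ->
          forall zeta : 'M[R]_n,
            parallel_transport nabla I (geod beta X V) 0 t eta zeta <->
            zeta = transport beta X V eta t].
Proof.
split.
- by move=> A; exact: qformE.
- move=> nabla; split; first exact: levi_civita_christoffel.
  exact: christoffel_levi_civita.
- move=> nabla LC X V I GX oI itvI I0 c; split.
    by move=> [geo c0 c'0]; exact: (geodesic_eq_geod hbeta LC oI itvI I0 GX).
  exact: eq_geod_geodesic.
- move=> nabla LC X V I GX oI itvI I0 eta t It zeta.
  exact: parallel_transportP.
Qed.
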